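(* Let $A$ be a Hopf algebra with bijective antipode, and let $(\Omega,\mathrm{d})$ be a bicovariant differential exterior algebra over $A$, corresponding to data $(\Lambda,\delta)$ (with first order data $(\Lambda^1,\omega)$) as described in the context. Then $(\Omega,\mathrm{d})$ is strongly bicovariant if and only if $\Lambda$ is a graded braided-super Hopf algebra in the category of right $A$-crossed modules and $\delta$ obeys in addition $$(\delta\eta)^1\otimes(\delta\eta)^2=\delta\eta^1\otimes\eta^2+(-1)^{|\eta^1|}\eta^1\otimes\delta\eta^2+(-1)^{|\eta^1|}(\eta^1)_0\otimes\omega(\pi((\eta^1)_1))\,\eta^2$$ for all $\eta\in\Lambda$, where $\underline{\Delta}\eta=\eta^1\otimes\eta^2$ denotes the braided coproduct of $\Lambda$ and $\Delta_R\eta=\eta_0\otimes\eta_1$ denotes the right coaction of $A$ on $\Lambda$.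
   Context: We work over a field $k$ of characteristic not $2$. $A^+=\ker\epsilon$, $\pi(a)=a-\epsilon(a)1$. A right $A$-crossed module is a vector space $V$ with a right action $\triangleleft$ and right coaction $\Delta_Rv=v_0\otimes v_1$ of $A$ such that $\Delta_R(v\triangleleft a)=v_0\triangleleft a_{(2)}\otimes(Sa_{(1)})v_1a_{(3)}$; these form a braided category with $\Psi(v\otimes w)=w_0\otimes v\triangleleft w_1$. $A^+$ is a crossed module by $a\triangleleft b=ab$, $\Delta_R(a)=a_{(2)}\otimes(Sa_{(1)})a_{(3)}$. A differential exterior algebra over $A$ is a graded algebra $\Omega=\oplus_{n\ge0}\Omega^n$ with $\Omega^0=A$ and a degree $1$ super-derivation $\mathrm{d}$ with $\mathrm{d}^2=0$. It is bicovariant if $\Omega$ is an $A$-bicomodule algebra with graded coactions $\Delta_L,\Delta_R$ restricting to the coproduct on $A$, and $\mathrm{d}$ is a bicomodule map. Bicovariant differential exterior algebras correspond to data $(\Lambda,\delta)$: $\Lambda=\oplus_n\Lambda^n$ with $\Lambda^0=k$ is a graded algebra in the category of right $A$-crossed modules, $\omega:A^+\to\Lambda^1$ is a crossed module morphism, and $\delta:\Lambda\to\Lambda$ is a degree $1$ super-derivation and right $A$-comodule map with $\delta^2=0$, $(\delta\eta)\triangleleft a-\delta(\eta\triangleleft a)=\omega(\pi(a_{(1)}))(\eta\triangleleft a_{(2)})-(-1)^{|\eta|}(\eta\triangleleft a_{(1)})\omega(\pi(a_{(2)}))$ for all $a\in A$, and $\delta\omega(a)+\omega(\pi(a_{(1)}))\omega(\pi(a_{(2)}))=0$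 for all $a\in A^+$. Here $\Omega\cong A\otimes\Lambda$ with product $(a\otimes\eta)(b\otimes\zeta)=ab_{(1)}\otimes(\eta\triangleleft b_{(2)})\zeta$, coactions $\Delta_L=\Delta\otimes\mathrm{id}$, $\Delta_R(a\otimes\eta)=a_{(1)}\otimes\eta_0\otimes a_{(2)}\eta_1$, and $\mathrm{d}(a\otimes\eta)=a_{(1)}\otimes\omega(\pi(a_{(2)}))\eta+a\otimes\delta\eta$. $(\Omega,\mathrm{d})$ is strongly bicovariant if $\Omega$ is a graded super-Hopf algebra (extending the Hopf algebra $A=\Omega^0$, with parity given by the degree) and $\mathrm{d}$ is a super-coderivation: $\Delta\mathrm{d}w=(\mathrm{d}\otimes\mathrm{id}+(-1)^{|\ |}\otimes\mathrm{d})\Delta w$ for all $w\in\Omega$, where $(-1)^{|\ |}w=(-1)^{|w|}w$. The bicomodule structure is the one induced by the super-coproduct: $\Delta_L=(\Pi\otimes\mathrm{id})\Delta$, $\Delta_R=(\mathrm{id}\otimes\Pi)\Delta$, with $\Pi:\Omega\to A$ the projection to degree $0$. The correspondence of super-Hopf structures is by super-bosonisation: $\Delta(a\otimes\eta)=a_{(1)}\otimes(\eta^1)_0\otimes a_{(2)}(\eta^1)_1\otimes\eta^2$. A graded braided-super Hopf algebra $\Lambda$ is a graded Hopf algebra in the braided category of crossed modules with the braiding modified by super-signs, i.e. $\underline\Delta$ is an algebra map for $(v\otimes w)(v'\otimes w')=(-1)^{|w||v'|}v\,v'_0\otimes(w\triangleleft v'_1)w'$. *)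

(* Defs.v *)
From HB Require Import structures.
From mathcomp Require Import all_boot all_algebra generic_quotient.
From mathcomp Require Import boolp classical_sets functions cardinality fsbigop.

Set Implicit Arguments.
Unset Strict Implicit.
Unset Printing Implicit Defensive.

Import GRing.Theory.
Local Open Scope classical_set_scope.
Local Open Scope quotient_scope.
Local Open Scope ring_scope.

Reserved Notation "x ⊗ y" (at level 40, left associativity).
Reserved Notation "\sw_ ( x ⊗ y <- t ) E"
  (at level 41, x name, y name, t at level 99, E at level 41,
   format "'[' \sw_ ( x  ⊗  y  <-  t ) '/  '  E ']'").

(** * Tensor products

  [tens V W] is the type of formal sums of pairs, two formal sums being
  identified when every bilinear map into every vector space takes the same
  value on both, i.e. when they agree modulo the bilinearity relations.
  [\sw_(x ⊗ y <- t) f x y] is the value at [t] of the linear map on [tens V W]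
  induced by the bilinear map [f]; it plays the role of Sweedler notation and
  is only used for bilinear [f] (see [tlift_pure], [tlift_is_linear]). *)

Section Tensor.
Variable k : fieldType.

Definition bilin (V W U : lmodType k) (f : V -> W -> U) : Prop :=
  (forall v, linear (f v)) /\ (forall w, linear (f^~ w)).

Variables V W : lmodType k.

Definition formal_eval (U : lmodType k) (f : V -> W -> U) (s : seq (V * W)) : U :=
  \sum_(p <- s) f p.1 p.2.

Definition tens_eq : rel (seq (V * W)) := fun s t =>
  `[< forall (U : lmodType k) (f : V -> W -> U), bilin f ->
        formal_eval f s = formal_eval f t >].

Lemma tens_eq_refl : reflexive tens_eq.
Proof. by move=> s; apply/asboolP. Qed.

Lemma tens_eq_sym : symmetric tens_eq.
Proof. by move=> s t; apply/asboolP/asboolP => h U f hf; rewrite h. Qed.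

Lemma tens_eq_trans : transitive tens_eq.
Proof.
move=> t s r /asboolP h1 /asboolP h2; apply/asboolP => U f hf.
by rewrite h1 // h2.
Qed.

Canonical tens_eq_equiv := EquivRel tens_eq tens_eq_refl tens_eq_sym tens_eq_trans.

Definition tens := {eq_quot tens_eq}.

HB.instance Definition _ := Choice.on tens.
HB.instance Definition _ := EqQuotient.on tens.

Definition tpure (v : V) (w : W) : tens := \pi_tens [:: (v, w)].

Definition tlift (U : lmodType k) (f : V -> W -> U) (t : tens) : U :=
  formal_eval f (repr t).

Lemma tens_piP (s t : seq (V * W)) :
  (\pi_tens s = \pi_tens t) <->
  (forall (U : lmodType k) (f : V -> W -> U), bilin f ->
     formal_eval f s = formal_eval f t).
Proof. by split=> [/eqmodP/asboolP//|h]; apply/eqmodP/asboolP. Qed.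

Lemma tlift_pi (U : lmodType k) (f : V -> W -> U) s :
  bilin f -> tlift f (\pi_tens s) = formal_eval f s.
Proof. by move=> hf; apply: (tens_piP _ _).1 => //; rewrite reprK. Qed.

Definition tens_zero : tens := \pi_tens [::].
Definition tens_add (s t : tens) : tens := \pi_tens (repr s ++ repr t).
Definition tens_scale (a : k) (t : tens) : tens :=
  \pi_tens [seq (a *: p.1, p.2) | p <- repr t].
Definition tens_opp (t : tens) : tens := tens_scale (-1) t.

Lemma tlift_add (U : lmodType k) (f : V -> W -> U) s t : bilin f ->
  tlift f (tens_add s t) = tlift f s + tlift f t.
Proof. by move=> hf; rewrite tlift_pi // /formal_eval big_cat. Qed.

Lemma tlift_scale (U : lmodType k) (f : V -> W -> U) a t : bilin f ->
  tlift f (tens_scale a t) = a *: tlift f t.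
Proof.
move=> hf; rewrite tlift_pi // /formal_eval big_map scaler_sumr.
apply: eq_bigr => p _ /=; have := hf.2 p.2 a p.1 0.
have -> : f 0 p.2 = 0.
  by have := hf.2 p.2 (-1) 0 0; rewrite scaler0 addr0 scaleN1r addNr.
by rewrite !addr0.
Qed.

Lemma tlift0 (U : lmodType k) (f : V -> W -> U) : bilin f ->
  tlift f tens_zero = 0.
Proof. by move=> hf; rewrite tlift_pi // /formal_eval big_nil. Qed.

Lemma tens_sep (s t : tens) :
  (forall (U : lmodType k) (f : V -> W -> U), bilin f -> tlift f s = tlift f t) ->
  s = t.
Proof. by move=> h; rewrite -(reprK s) -(reprK t); apply/tens_piP. Qed.

Fact tens_addA : associative tens_add.
Proof. by move=> x y z; apply: tens_sep => U f hf; rewrite !tlift_add // addrA. Qed.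
Fact tens_addC : commutative tens_add.
Proof. by move=> x y; apply: tens_sep => U f hf; rewrite !tlift_add // addrC. Qed.
Fact tens_add0 : left_id tens_zero tens_add.
Proof. by move=> x; apply: tens_sep => U f hf; rewrite tlift_add // tlift0 // add0r. Qed.
Fact tens_addN : left_inverse tens_zero tens_opp tens_add.
Proof.
move=> x; apply: tens_sep => U f hf.
by rewrite tlift_add // tlift_scale // tlift0 // scaleN1r addNr.
Qed.

HB.instance Definition _ :=
  GRing.isZmodule.Build tens tens_addA tens_addC tens_add0 tens_addN.

Fact tens_scaleA a b t : tens_scale a (tens_scale b t) = tens_scale (a * b) t.
Proof. by apply: tens_sep => U f hf; rewrite !tlift_scale // scalerA. Qed.
Fact tens_scale1 : left_id 1 tens_scale.
Proof. by move=> t; apply: tens_sep => U f hf; rewrite tlift_scale // scale1r. Qed.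
Fact tens_scaleDr : right_distributive tens_scale +%R.
Proof.
move=> a s t; apply: tens_sep => U f hf.
by rewrite tlift_scale // !tlift_add // scalerDr !tlift_scale.
Qed.
Fact tens_scaleDl t : {morph tens_scale^~ t : a b / a + b}.
Proof.
move=> a b; apply: tens_sep => U f hf.
by rewrite tlift_scale // tlift_add // scalerDl !tlift_scale.
Qed.

HB.instance Definition _ := GRing.Zmodule_isLmodule.Build k tens
  tens_scaleA tens_scale1 tens_scaleDr tens_scaleDl.

Lemma tpure_bilin : bilin tpure.
Proof.
split=> [v a w w'|w a v v']; apply: tens_sep => U f hf;
  rewrite [RHS]tlift_add // tlift_scale // !tlift_pi // /formal_eval !big_seq1 /=.
- exact: hf.1.
- exact: hf.2.
Qed.

Lemma tlift_pure (U : lmodType k) (f : V -> W -> U) v w :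
  bilin f -> tlift f (tpure v w) = f v w.
Proof. by move=> hf; rewrite tlift_pi // /formal_eval big_seq1. Qed.

Lemma tlift_is_linear (U : lmodType k) (f : V -> W -> U) :
  bilin f -> linear (tlift f).
Proof. by move=> hf a s t; rewrite tlift_add // tlift_scale. Qed.

Lemma eq_tlift (U : lmodType k) (f g : V -> W -> U) t :
  (forall v w, f v w = g v w) -> tlift f t = tlift g t.
Proof. by move=> h; apply: eq_bigr. Qed.

Lemma linear_tlift (U U' : lmodType k) (g : U -> U') (f : V -> W -> U) t :
  linear g -> g (tlift f t) = tlift (fun v w => g (f v w)) t.
Proof.
move=> hl; pose F : {linear U -> U'} := HB.pack g (GRing.isLinear.Build _ _ _ _ _ hl).
exact: (raddf_sum F).
Qed.

Lemma tens_sum_pure (t : tens) : t = \sum_(p <- repr t) tpure p.1 p.2.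
Proof.
apply: tens_sep => U f hf; have hl := tlift_is_linear hf.
pose F : {linear tens -> U} := HB.pack (tlift f) (GRing.isLinear.Build _ _ _ _ _ hl).
rewrite [RHS](_ : _ = F (\sum_(p <- repr t) tpure p.1 p.2)) // raddf_sum.
by apply: eq_bigr => p _; rewrite /= tlift_pure.
Qed.

End Tensor.

Notation "x ⊗ y" := (tpure x y) : ring_scope.
Notation "\sw_ ( x ⊗ y <- t ) E" := (tlift (fun x y => E) t) : ring_scope.


Section Hopf.
Variable k : fieldType.

Definition coassociative (C : lmodType k) (D : C -> tens C C) : Prop :=
  forall c, \sw_(x ⊗ y <- D c) \sw_(y1 ⊗ y2 <- D y) x ⊗ (y1 ⊗ y2)
          = \sw_(x ⊗ y <- D c) \sw_(x1 ⊗ x2 <- D x) x1 ⊗ (x2 ⊗ y).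

Definition counital (C : lmodType k) (D : C -> tens C C) (e : C -> k) : Prop :=
  forall c, \sw_(x ⊗ y <- D c) e x *: y = c /\ \sw_(x ⊗ y <- D c) e y *: x = c.

Definition is_antipode (C : algType k) (D : C -> tens C C) (e : C -> k)
    (S : C -> C) : Prop :=
  forall c, \sw_(x ⊗ y <- D c) S x * y = e c *: 1 /\
            \sw_(x ⊗ y <- D c) x * S y = e c *: 1.

Definition is_character (C : algType k) (e : C -> k) : Prop :=
  e 1 = 1 /\ (forall x y, e (x * y) = e x * e y).

Record hopf (A : algType k) := Hopf {
  comul : {linear A -> tens A A};
  counit : {scalar A};
  antipode : {linear A -> A};
  comul_coassoc : coassociative comul;
  comul_counital : counital comul counit;
  comul1 : comul 1 = 1 ⊗ 1;
  comulM : forall a b, comul (a * b) =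
    \sw_(a1 ⊗ a2 <- comul a) \sw_(b1 ⊗ b2 <- comul b) (a1 * b1) ⊗ (a2 * b2);
  counit_char : is_character counit;
  antipodeP : is_antipode comul counit antipode }.

Section OverHopf.
Variables (A : algType k) (H : hopf A).

Definition is_right_action (V : lmodType k) (act : V -> A -> V) : Prop :=
  [/\ bilin act, forall v, act v 1 = v &
      forall v a b, act (act v a) b = act v (a * b)].

Definition is_right_coaction (V : lmodType k) (co : V -> tens V A) : Prop :=
  [/\ linear co,
      forall v, \sw_(x ⊗ a <- co v) \sw_(y ⊗ b <- co x) y ⊗ (b ⊗ a)
              = \sw_(x ⊗ a <- co v) \sw_(a1 ⊗ a2 <- comul H a) x ⊗ (a1 ⊗ a2) &
      forall v, \sw_(x ⊗ a <- co v) counit H a *: x = v].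

Definition is_left_coaction (V : lmodType k) (co : V -> tens A V) : Prop :=
  [/\ linear co,
      forall v, \sw_(a ⊗ x <- co v) \sw_(b ⊗ y <- co x) a ⊗ (b ⊗ y)
              = \sw_(a ⊗ x <- co v) \sw_(a1 ⊗ a2 <- comul H a) a1 ⊗ (a2 ⊗ x) &
      forall v, \sw_(a ⊗ x <- co v) counit H a *: x = v].

Record crossed_module (V : lmodType k) := CrossedModule {
  act : V -> A -> V;
  coact : V -> tens V A;
  actP : is_right_action act;
  coactP : is_right_coaction coact;
  crossedP : forall v a, coact (act v a) =
    \sw_(v0 ⊗ v1 <- coact v) \sw_(a1 ⊗ a' <- comul H a)
      \sw_(a2 ⊗ a3 <- comul H a') act v0 a2 ⊗ (antipode H a1 * v1 * a3) }.


Definition augmentation : {pred A} := [pred a | counit H a == 0].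

Fact augmentation_closed : submod_closed augmentation.
Proof.
split=> [|c x y]; rewrite !inE ?linear0 // => /eqP hx /eqP hy.
by rewrite linearP hx hy /= mulr0 addr0.
Qed.

HB.instance Definition _ :=
  GRing.isSubmodClosed.Build k A augmentation augmentation_closed.

Record aug := Aug { aug_val : A; aug_valP : aug_val \in augmentation }.

HB.instance Definition _ := [isSub for aug_val].
HB.instance Definition _ := [Choice of aug by <:].
HB.instance Definition _ := [SubChoice_isSubLmodule of aug by <:].

Fact augmentation_proj a : a - counit H a *: 1 \in augmentation.
Proof.
by rewrite inE linearB linearZ /= (counit_char H).1 mulr1 subrr.
Qed.

Definition aug_proj (a : A) : aug := Aug (augmentation_proj a).

(* As [aug_proj] fixes [A^+], [aug_act] is [a b], and [aug_coact] is
   [a_(2) ⊗ S a_(1) a_(3)], an element of [tens A^+ A] for [a] in [A^+]. *)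
Definition aug_act (a : aug) (b : A) : aug := aug_proj (val a * b).

Definition aug_coact (a : aug) : tens aug A :=
  \sw_(a1 ⊗ a' <- comul H (val a)) \sw_(a2 ⊗ a3 <- comul H a')
    aug_proj a2 ⊗ (antipode H a1 * a3).

Lemma val_aug_act a b : val (aug_act a b) = val a * b.
Proof.
have /eqP ea := aug_valP a.
by rewrite /= (counit_char H).2 ea mul0r scale0r subr0.
Qed.

Lemma val_aug_coact a :
  \sw_(x ⊗ b <- aug_coact a) val x ⊗ b =
  \sw_(a1 ⊗ a' <- comul H (val a)) \sw_(a2 ⊗ a3 <- comul H a')
    a2 ⊗ (antipode H a1 * a3).
Proof.
have hb : bilin (fun (x : aug) (b : A) => val x ⊗ b).
  by split=> [v c w w'|w c v v']; rewrite ?linearP /=;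
     [apply: (tpure_bilin _ _).1|apply: (tpure_bilin _ _).2].
pose u (b : A) : tens A A := 1 ⊗ b.
have hu : linear u := (tpure_bilin _ _).1 1.
have u0 : u 0 = 0 by have := hu (-1) 0 0; rewrite scaler0 addr0 scaleN1r addNr.
rewrite /aug_coact linear_tlift; last exact: tlift_is_linear hb.
under eq_tlift => a1 a'.
  rewrite linear_tlift; last exact: tlift_is_linear hb.
  under eq_tlift => a2 a3 do rewrite (tlift_pure _ _ hb).
  over.
apply/eqP; rewrite -subr_eq0; apply/eqP.
rewrite /tlift /formal_eval -sumrB.
transitivity (- u (\sw_(a1 ⊗ a' <- comul H (val a)) antipode H a1 * a')).
  rewrite (linear_tlift _ _ hu) /tlift /formal_eval -sumrN.
  apply: eq_bigr => p _; rewrite -sumrB -[in RHS](comul_counital H p.2).1.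
  have hl : linear (fun x => u (antipode H p.1 * x)).
    by move=> c x y; rewrite mulrDr -scalerAr hu.
  rewrite (linear_tlift _ _ hl) -sumrN; apply: eq_bigr => q _ /=.
  rewrite -scalerAr; have := hu (counit H q.1) (antipode H p.1 * q.2) 0.
  rewrite u0 !addr0 => ->.
  have /= h := (tpure_bilin _ _).2 (antipode H p.1 * q.2) (- counit H q.1) (1 : A) q.1.
  have -> : q.1 - counit H q.1 *: 1 = - counit H q.1 *: 1 + q.1.
    by rewrite addrC scaleNr.
  by rewrite h addrK scaleNr.
have /eqP ea := aug_valP a.
by rewrite (antipodeP H _).1 ea scale0r u0 oppr0.
Qed.

End OverHopf.
End Hopf.


Section Graded.
Variable k : fieldType.

(* A decomposition of [V] as a direct sum over [nat]; [hcomp n] is the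
   projection onto the component of degree [n]. *)
Record grading (V : lmodType k) := Grading {
  hcomp : nat -> {linear V -> V};
  hcomp_idem : forall m n v,
    hcomp m (hcomp n v) = if m == n then hcomp n v else 0;
  hcomp_fin : forall v, finite_set [set n | hcomp n v != 0];
  hcomp_sum : forall v, \sum_(n \in [set: nat]) hcomp n v = v }.

Definition homog (V : lmodType k) (G : grading V) (n : nat) (v : V) : Prop :=
  hcomp G n v = v.

Definition degree_map (V W : lmodType k) (GV : grading V) (GW : grading W)
    (d : nat) (f : V -> W) : Prop :=
  forall n v, homog GV n v -> homog GW (n + d) (f v).

(* [v] |-> [(-1)^{|v|} v] *)
Definition ssign (V : lmodType k) (G : grading V) (v : V) : V :=
  \sum_(n \in [set: nat]) (-1) ^+ n *: hcomp G n v.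

Definition graded_algebra (B : algType k) (G : grading B) : Prop :=
  homog G 0 1 /\
  (forall m n x y, homog G m x -> homog G n y -> homog G (m + n) (x * y)).

Definition super_derivation (B : algType k) (G : grading B) (d : B -> B) : Prop :=
  forall n x y, homog G n x -> d (x * y) = d x * y + (-1) ^+ n *: (x * d y).

Definition graded_coproduct (C : lmodType k) (G : grading C)
    (D : C -> tens C C) : Prop :=
  forall n c, homog G n c ->
    D c = \sw_(x ⊗ y <- D c) \sum_(i < n.+1) hcomp G i x ⊗ hcomp G (n - i) y.

Definition graded_counit (C : lmodType k) (G : grading C) (e : C -> k) : Prop :=
  forall n c, homog G n.+1 c -> e c = 0.

(* [(-1)^{|y||x'|} x x' ⊗ y y'] *)
Definition super_tmul (B : algType k) (G : grading B) (x y x' y' : B) : tens B B :=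
  \sum_(m \in [set: nat]) \sum_(n \in [set: nat])
    (-1) ^+ (m * n) *: ((x * hcomp G n x') ⊗ (hcomp G m y * y')).

End Graded.


Section Exterior.
Variables (k : fieldType) (A : algType k) (H : hopf A).

(* [Ω^0 = A] is expressed by the algebra map [iota] from [A] to [Ω], which is
   a bijection onto the degree [0] component with inverse induced by [proj0]. *)
Record diff_ext_alg (Om : algType k) := DiffExtAlg {
  Om_gr : grading Om;
  Om_graded : graded_algebra Om_gr;
  iota : {lrmorphism A -> Om};
  proj0 : {linear Om -> A};
  iota_proj0 : forall w, iota (proj0 w) = hcomp Om_gr 0 w;
  proj0_iota : forall a, proj0 (iota a) = a;
  diff : {linear Om -> Om};
  diff_degree : degree_map Om_gr Om_gr 1 diff;
  diff_super_derivation : super_derivation Om_gr diff;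
  diff_diff : forall w, diff (diff w) = 0 }.

Record bicovariant_alg (Om : algType k) := BicovariantAlg {
  bic_dea :> diff_ext_alg Om;
  coL : {linear Om -> tens A Om};
  coR : {linear Om -> tens Om A};
  coLP : is_left_coaction H coL;
  coRP : is_right_coaction H coR;
  coLR : forall w, \sw_(a ⊗ x <- coL w) \sw_(y ⊗ b <- coR x) a ⊗ (y ⊗ b)
                 = \sw_(x ⊗ b <- coR w) \sw_(a ⊗ y <- coL x) a ⊗ (y ⊗ b);
  coL1 : coL 1 = 1 ⊗ 1;
  coLM : forall v w, coL (v * w) =
    \sw_(a ⊗ x <- coL v) \sw_(b ⊗ y <- coL w) (a * b) ⊗ (x * y);
  coR1 : coR 1 = 1 ⊗ 1;
  coRM : forall v w, coR (v * w) =
    \sw_(x ⊗ a <- coR v) \sw_(y ⊗ b <- coR w) (x * y) ⊗ (a * b);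
  coL_graded : forall n w, homog (Om_gr bic_dea) n w ->
    coL w = \sw_(a ⊗ x <- coL w) a ⊗ hcomp (Om_gr bic_dea) n x;
  coR_graded : forall n w, homog (Om_gr bic_dea) n w ->
    coR w = \sw_(x ⊗ a <- coR w) hcomp (Om_gr bic_dea) n x ⊗ a;
  coL_iota : forall a, coL (iota bic_dea a) =
    \sw_(a1 ⊗ a2 <- comul H a) a1 ⊗ iota bic_dea a2;
  coR_iota : forall a, coR (iota bic_dea a) =
    \sw_(a1 ⊗ a2 <- comul H a) iota bic_dea a1 ⊗ a2;
  coL_diff : forall w, coL (diff bic_dea w) =
    \sw_(a ⊗ x <- coL w) a ⊗ diff bic_dea x;
  coR_diff : forall w, coR (diff bic_dea w) =
    \sw_(x ⊗ a <- coR w) diff bic_dea x ⊗ a }.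

Record bicovariant_data (La : algType k) := BicovariantData {
  La_gr : grading La;
  La_graded : graded_algebra La_gr;
  La_deg0 : forall x, homog La_gr 0 x -> exists c : k, x = c *: 1;
  La_cross : crossed_module H La;
  La_act_graded : forall n x a, homog La_gr n x ->
    homog La_gr n (act La_cross x a);
  La_coact_graded : forall n x, homog La_gr n x ->
    coact La_cross x =
      \sw_(x0 ⊗ x1 <- coact La_cross x) hcomp La_gr n x0 ⊗ x1;
  La_act1 : forall a, act La_cross 1 a = counit H a *: 1;
  La_actM : forall x y a, act La_cross (x * y) a =
    \sw_(a1 ⊗ a2 <- comul H a) act La_cross x a1 * act La_cross y a2;
  La_coact1 : coact La_cross 1 = 1 ⊗ 1;
  La_coactM : forall x y, coact La_cross (x * y) =
    \sw_(x0 ⊗ x1 <- coact La_cross x) \sw_(y0 ⊗ y1 <- coact La_cross y)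
      (x0 * y0) ⊗ (x1 * y1);
  omega : {linear aug H -> La};
  omega_degree : forall a, homog La_gr 1 (omega a);
  omega_act : forall a b, omega (aug_act a b) = act La_cross (omega a) b;
  omega_coact : forall a, coact La_cross (omega a) =
    \sw_(a0 ⊗ a1 <- aug_coact a) omega a0 ⊗ a1;
  delta : {linear La -> La};
  delta_degree : degree_map La_gr La_gr 1 delta;
  delta_super_derivation : super_derivation La_gr delta;
  delta_coact : forall x, coact La_cross (delta x) =
    \sw_(x0 ⊗ x1 <- coact La_cross x) delta x0 ⊗ x1;
  delta_delta : forall x, delta (delta x) = 0;
  delta_act : forall n x a, homog La_gr n x ->
    act La_cross (delta x) a - delta (act La_cross x a) =
    \sw_(a1 ⊗ a2 <- comul H a)
      (omega (aug_proj H a1) * act La_cross x a2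
       - (-1) ^+ n *: (act La_cross x a1 * omega (aug_proj H a2)));
  delta_omega : forall a : aug H,
    delta (omega a) + \sw_(a1 ⊗ a2 <- comul H (val a))
      omega (aug_proj H a1) * omega (aug_proj H a2) = 0 }.

(* [phi] is an isomorphism from the bicovariant differential exterior algebra
   [A ⊗ Λ] built from the data to [Ω]. *)
Record corresponds (Om La : algType k) (E : bicovariant_alg Om)
    (X : bicovariant_data La) (phi : {linear tens A La -> Om}) : Prop :=
  Corresponds {
  phi_bij : bijective phi;
  phi_iota : forall a, phi (a ⊗ 1) = iota E a;
  phi_graded : forall n a x, homog (La_gr X) n x ->
    homog (Om_gr E) n (phi (a ⊗ x));
  phi_mul : forall a x b y, phi (a ⊗ x) * phi (b ⊗ y) =
    phi (\sw_(b1 ⊗ b2 <- comul H b) (a * b1) ⊗ (act (La_cross X) x b2 * y));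
  phi_coL : forall a x, coL E (phi (a ⊗ x)) =
    \sw_(a1 ⊗ a2 <- comul H a) a1 ⊗ phi (a2 ⊗ x);
  phi_coR : forall a x, coR E (phi (a ⊗ x)) =
    \sw_(a1 ⊗ a2 <- comul H a) \sw_(x0 ⊗ x1 <- coact (La_cross X) x)
      phi (a1 ⊗ x0) ⊗ (a2 * x1);
  phi_diff : forall a x, diff E (phi (a ⊗ x)) =
    phi (\sw_(a1 ⊗ a2 <- comul H a) a1 ⊗ (omega X (aug_proj H a2) * x)
         + a ⊗ delta X x) }.


Record super_hopf (Om : algType k) (E : diff_ext_alg Om)
    (D : {linear Om -> tens Om Om}) (e : {scalar Om}) (S : {linear Om -> Om})
    : Prop := SuperHopf {
  sh_coassoc : coassociative D;
  sh_counital : counital D e;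
  sh_graded : graded_coproduct (Om_gr E) D;
  sh_counit_graded : graded_counit (Om_gr E) e;
  sh_antipode_graded : degree_map (Om_gr E) (Om_gr E) 0 S;
  sh_comul1 : D 1 = 1 ⊗ 1;
  sh_comulM : forall v w, D (v * w) =
    \sw_(v1 ⊗ v2 <- D v) \sw_(w1 ⊗ w2 <- D w)
      super_tmul (Om_gr E) v1 v2 w1 w2;
  sh_counit_char : is_character e;
  sh_antipode : is_antipode D e S;
  sh_comul_iota : forall a, D (iota E a) =
    \sw_(a1 ⊗ a2 <- comul H a) iota E a1 ⊗ iota E a2;
  sh_counit_iota : forall a, e (iota E a) = counit H a;
  sh_antipode_iota : forall a, S (iota E a) = iota E (antipode H a) }.

Definition super_coderivation (Om : algType k) (E : diff_ext_alg Om)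
    (D : Om -> tens Om Om) : Prop :=
  forall w, D (diff E w) =
    \sw_(x ⊗ y <- D w) (diff E x ⊗ y + ssign (Om_gr E) x ⊗ diff E y).

Record strongly_bicovariant_with (Om : algType k) (E : bicovariant_alg Om)
    (D : {linear Om -> tens Om Om}) : Prop := StronglyBicovariantWith {
  sb_super_hopf : exists e S, super_hopf E D e S;
  sb_coderivation : super_coderivation E D;
  sb_coL : forall w, coL E w = \sw_(x ⊗ y <- D w) proj0 E x ⊗ y;
  sb_coR : forall w, coR E w = \sw_(x ⊗ y <- D w) x ⊗ proj0 E y }.

Definition strongly_bicovariant (Om : algType k) (E : bicovariant_alg Om) : Prop :=
  exists D, strongly_bicovariant_with E D.


(* [(-1)^{|y||x'|} x x'_0 ⊗ (y ◁ x'_1) y'] *)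
Definition braided_super_tmul (La : algType k) (G : grading La)
    (C : crossed_module H La) (x y x' y' : La) : tens La La :=
  \sum_(m \in [set: nat]) \sum_(n \in [set: nat])
    (-1) ^+ (m * n) *: \sw_(z0 ⊗ z1 <- coact C (hcomp G n x'))
      (x * z0) ⊗ (act C (hcomp G m y) z1 * y').

Record braided_super_hopf (La : algType k) (X : bicovariant_data La)
    (D : {linear La -> tens La La}) (e : {scalar La}) (S : {linear La -> La})
    : Prop := BraidedSuperHopf {
  bsh_coassoc : coassociative D;
  bsh_counital : counital D e;
  bsh_graded : graded_coproduct (La_gr X) D;
  bsh_counit_graded : graded_counit (La_gr X) e;
  bsh_antipode_graded : degree_map (La_gr X) (La_gr X) 0 S;
  bsh_comul_act : forall x a, D (act (La_cross X) x a) =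
    \sw_(x1 ⊗ x2 <- D x) \sw_(a1 ⊗ a2 <- comul H a)
      act (La_cross X) x1 a1 ⊗ act (La_cross X) x2 a2;
  bsh_comul_coact : forall x,
    \sw_(x0 ⊗ x1 <- coact (La_cross X) x) D x0 ⊗ x1 =
    \sw_(y ⊗ z <- D x) \sw_(y0 ⊗ y1 <- coact (La_cross X) y)
      \sw_(z0 ⊗ z1 <- coact (La_cross X) z) (y0 ⊗ z0) ⊗ (y1 * z1);
  bsh_counit_act : forall x a, e (act (La_cross X) x a) = e x * counit H a;
  bsh_counit_coact : forall x,
    \sw_(x0 ⊗ x1 <- coact (La_cross X) x) e x0 *: x1 = e x *: 1;
  bsh_antipode_act : forall x a, S (act (La_cross X) x a) = act (La_cross X) (S x) a;
  bsh_antipode_coact : forall x, coact (La_cross X) (S x) =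
    \sw_(x0 ⊗ x1 <- coact (La_cross X) x) S x0 ⊗ x1;
  bsh_comul1 : D 1 = 1 ⊗ 1;
  bsh_comulM : forall x y, D (x * y) =
    \sw_(x1 ⊗ x2 <- D x) \sw_(y1 ⊗ y2 <- D y)
      braided_super_tmul (La_gr X) (La_cross X) x1 x2 y1 y2;
  bsh_counit_char : is_character e;
  bsh_antipode : is_antipode D e S }.

Definition is_braided_super_hopf (La : algType k) (X : bicovariant_data La)
    (D : {linear La -> tens La La}) : Prop :=
  exists e S, braided_super_hopf X D e S.

Definition delta_condition (La : algType k) (X : bicovariant_data La)
    (D : La -> tens La La) : Prop :=
  forall x, D (delta X x) =
    \sw_(x1 ⊗ x2 <- D x)
      (delta X x1 ⊗ x2
       + ssign (La_gr X) x1 ⊗ delta X x2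
       + \sw_(y0 ⊗ y1 <- coact (La_cross X) (ssign (La_gr X) x1))
           y0 ⊗ (omega X (aug_proj H y1) * x2)).

(* [DOm] is the coproduct of the super-bosonisation of [(Λ, DLa)]. *)
Definition super_bosonisation (Om La : algType k) (X : bicovariant_data La)
    (phi : tens A La -> Om) (DLa : La -> tens La La) (DOm : Om -> tens Om Om) : Prop :=
  forall a x, DOm (phi (a ⊗ x)) =
    \sw_(a1 ⊗ a2 <- comul H a) \sw_(x1 ⊗ x2 <- DLa x)
      \sw_(y0 ⊗ y1 <- coact (La_cross X) x1)
        phi (a1 ⊗ y0) ⊗ phi ((a2 * y1) ⊗ x2).

End Exterior.

(* Main.v *)
From HB Require Import structures.
From mathcomp Require Import all_boot all_algebra.
From mathcomp Require Import boolp classical_sets cardinality fsbigop.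
Require Import Defs.

(** The algebra [Om] is the smash product of [A] and [La]: with [i x = phi (1 ⊗ x)],
  each element is a sum of products [a * i x].  Let [P (a * i x) = eps a x], a
  coalgebra projection which is right [La]-linear and intertwines right
  multiplication by [A] with the action.

  From a super-Hopf structure on [Om], the elements [i x] are left coinvariant,
  so coassociativity puts [D (i x)] in bosonised form for the coproduct
  [Dl x = (P ⊗ P) D (i x)]; since [(P ⊗ P) D = Dl P], each axiom for [Dl], and the
  condition on [delta], is the image under [P ⊗ P] of the one for [D].  The map
  [x |-> S (i x_0) x_1] is a two-sided convolution inverse of [i], hence takes
  values in [La] and is the braided antipode.

  Conversely, the bosonised coproduct is multiplicative because it is so on the
  products [a w], [i x a] and [i x i y] and the super product on [Om ⊗ Om] is
  associative.  Then [D d] and [(d ⊗ id ± id ⊗ d) D] are derivations along [D], so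
  it suffices to compare them on [A], where only [omega] enters, and on the
  [i x], where equality is the condition on [delta]. *)

Set Implicit Arguments.
Unset Strict Implicit.
Unset Printing Implicit Defensive.

Import GRing.Theory.
Local Open Scope ring_scope.

(** Tensors are classes of formal sums, so each Sweedler manipulation carries a multilinearity side
    condition, and super signs are explicit only on homogeneous vectors. Identities are therefore
    reduced by linearity to pure tensors with homogeneous legs where signs occur.

    Three facts carry the computations. Since [Λ^0 = k], the degree zero part of [x] is the braided
    counit of [x] times [1], which relates the projection [Π] to the counit axioms. In the
    bosonisation, the antipode in [Δ_R(x ◁ b)] and in the coaction of [A^+] is cancelled through
    [b_(1) ⊗ b_(2) S b_(3) ⊗ b_(4) = b_(1) ⊗ 1 ⊗ b_(2)]. Finally, the second factor of [D (i x)]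
    contains a coaction leg: applying [d] to that leg gives the [ω] term of the condition on [δ],
    and the same leg is why the braided antipode is [S (i x_0) x_1] and not [S (i x)]. *)

Section Linearity.
Variable k : fieldType.
Implicit Types U V W T : lmodType k.

(** A constant head for [linear], on which hints and [lin_tac] can match; it applies to plain
    lambda-terms that carry no linear structure. *)
Definition lin V W (f : V -> W) : Prop := linear f.

Definition trilin V W T U (f : V -> W -> T -> U) : Prop :=
  [/\ forall w t, lin (fun v => f v w t), forall v t, lin (fun w => f v w t) &
      forall v w, lin (fun t => f v w t)].

Lemma bilinI V W U (f : V -> W -> U) :
  (forall v, lin (fun w => f v w)) -> (forall w, lin (fun v => f v w)) -> bilin f.
Proof. by []. Qed.

Lemma bilinl V W U (f : V -> W -> U) : bilin f -> forall w, lin (fun v => f v w).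
Proof. by case. Qed.

Lemma bilinr V W U (f : V -> W -> U) : bilin f -> forall v, lin (fun w => f v w).
Proof. by case. Qed.

Lemma lin_linear V W (f : {linear V -> W}) : lin f.
Proof. exact: linearP. Qed.

Lemma lin_id V : lin (fun v : V => v).
Proof. by []. Qed.

Lemma lin_add V W (f g : V -> W) : lin f -> lin g -> lin (fun v => f v + g v).
Proof. by move=> hf hg a u v; rewrite hf hg scalerDr addrACA. Qed.

Lemma lin_scale V W (c : k) (f : V -> W) : lin f -> lin (fun v => c *: f v).
Proof. by move=> hf a u v; rewrite hf scalerDr !scalerA mulrC. Qed.

Lemma lin_opp V W (f : V -> W) : lin f -> lin (fun v => - f v).
Proof. by move=> hf a u v; rewrite hf opprD scalerN. Qed.

Lemma lin0 V W (f : V -> W) : lin f -> f 0 = 0.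
Proof. by move=> hf; have /= := hf (-1) 0 0; rewrite scaler0 addr0 scaleN1r addNr. Qed.

Lemma linD V W (f : V -> W) u v : lin f -> f (u + v) = f u + f v.
Proof. by move=> hf; have /= := hf 1 u v; rewrite !scale1r. Qed.

Lemma linZ V W (f : V -> W) a v : lin f -> f (a *: v) = a *: f v.
Proof. by move=> hf; have /= := hf a v 0; rewrite (lin0 hf) !addr0. Qed.

Lemma linN V W (f : V -> W) v : lin f -> f (- v) = - f v.
Proof. by move=> hf; rewrite -scaleN1r linZ // scaleN1r. Qed.

Lemma lin_bigsum V W (f : V -> W) I r (P : pred I) F : lin f ->
  f (\sum_(i <- r | P i) F i) = \sum_(i <- r | P i) f (F i).
Proof.
move=> hf; apply: (big_morph f) => [u v|]; first exact: linD.
exact: lin0.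
Qed.

Lemma lin_comp U V W (g : V -> W) (f : U -> V) :
  lin g -> lin f -> lin (fun v => g (f v)).
Proof. by move=> hg hf a u v; rewrite hf hg. Qed.

Lemma lin_scalel V W (e : {scalar V}) (w : W) : lin (fun v => e v *: w).
Proof. by move=> a u v; rewrite linearP scalerDl scalerA. Qed.

Lemma lin_sum V W I r (P : pred I) (F : V -> I -> W) :
  (forall i, lin (fun v => F v i)) -> lin (fun v => \sum_(i <- r | P i) F v i).
Proof.
move=> hF a u v; rewrite scaler_sumr -big_split /=.
by apply: eq_bigr => i _; apply: hF.
Qed.

(* No bilinearity in [x] and [y] is needed: [tlift] is a sum over [repr t]. *)
Lemma lin_tlift_body U V W T (F : U -> V -> W -> T) t :
  (forall x y, lin (fun u => F u x y)) -> lin (fun u => tlift (F u) t).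
Proof. by move=> hF; apply: lin_sum => p; apply: hF. Qed.

Lemma lin_tlift V W T (F : V -> W -> T) : bilin F -> lin (tlift F).
Proof. exact: tlift_is_linear. Qed.

Lemma bilin_mul (B : algType k) : bilin (fun x y : B => x * y).
Proof.
split=> x a u v; first by rewrite mulrDr scalerAr.
by rewrite mulrDl scalerAl.
Qed.

Lemma bilin_tpure V W : bilin (fun (v : V) (w : W) => v ⊗ w).
Proof. exact: tpure_bilin. Qed.

End Linearity.

(* The hints of [lindb] are keyed on head symbols: [lin] and [bilin] goals with
   distinct heads are otherwise compared by unfolding, which may not terminate
   in reasonable time ([smul] and [bmul] unfold to [tlift]). *)
Create HintDb lindb.
#[export] Hint Extern 0 (bilin (@GRing.mul _)) => exact: bilin_mul : lindb.
#[export] Hint Extern 0 (bilin (@tpure _ _ _)) => exact: bilin_tpure : lindb.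
#[export] Hint Extern 9 (lin _) => exact: lin_linear : lindb.
Ltac lin_assumption :=
  match goal with
  | h : lin ?f |- lin ?f => exact h
  | h : bilin ?f |- bilin ?f => exact h
  end.
Ltac lin_atom := solve [lin_assumption | typeclasses eauto with lindb nocore].

(** Descends through the body of a lambda-term by second-order patterns. A metavariable without [@?]
    cannot capture the bound variable, so the branches for multilinear maps apply only when the
    variable occurs in a single argument. *)
Ltac lin_tac :=
  cbv beta;
  match goal with
  | |- trilin _ => split; do 2 intro; lin_tac
  | |- bilin _ => first [lin_assumption | apply: bilinI; intro; lin_tac]
  | |- lin (fun v => v) => exact: lin_id
  | |- lin (fun v => (@?f v) + (@?g v)) =>
      apply: (@lin_add _ _ _ f g); lin_tac
  | |- lin (fun v => - (@?f v)) => apply: (@lin_opp _ _ _ f); lin_tac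
  | |- lin (fun v => GRing.Linear.sort ?e (@?f v) *: ?w) =>
      apply: (@lin_comp _ _ _ _ (fun u => GRing.Linear.sort e u *: w) f);
      [exact: (@lin_scalel _ _ _ e w) | lin_tac]
  | |- lin (fun v => ?c *: (@?f v)) => apply: (@lin_scale _ _ _ c f); lin_tac
  | |- lin (fun v => \sum_(i <- ?r | @?P i) (@?F v i)) =>
      apply: (@lin_sum _ _ _ _ r P F); intro; lin_tac
  | |- lin (fun v => tlift (@?F v) ?t) =>
      apply: (@lin_tlift_body _ _ _ _ _ F t); do 2 intro; lin_tac
  | |- lin (fun v => tlift ?F (@?f v)) =>
      apply: (@lin_comp _ _ _ _ (tlift F) f); [apply: lin_tlift; lin_tac | lin_tac]
  | hh : trilin ?h |- lin (fun v => ?h (@?f v) ?w ?t) =>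
      apply: (@lin_comp _ _ _ _ (fun u => h u w t) f); [by case: hh | lin_tac]
  | hh : trilin ?h |- lin (fun v => ?h ?w (@?f v) ?t) =>
      apply: (@lin_comp _ _ _ _ (fun u => h w u t) f); [by case: hh | lin_tac]
  | hh : trilin ?h |- lin (fun v => ?h ?w ?t (@?f v)) =>
      apply: (@lin_comp _ _ _ _ (fun u => h w t u) f); [by case: hh | lin_tac]
  | |- lin (fun v => ?h (@?f v) ?w) =>
      apply: (@lin_comp _ _ _ _ (fun u => h u w) f);
      [apply: (@bilinl _ _ _ _ h); lin_atom | lin_tac]
  | |- lin (fun v => ?h ?w (@?f v)) =>
      apply: (@lin_comp _ _ _ _ (fun u => h w u) f);
      [apply: (@bilinr _ _ _ _ h); lin_atom | lin_tac]
  | |- lin (fun v => ?h (@?f v)) =>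
      apply: (@lin_comp _ _ _ _ h f);
      [lin_atom | lin_tac]
  | |- lin ?h => lin_atom
  | |- lin (?h ?a) => change (lin (fun v => h a v)); lin_tac
  end.
(* Placed in [core] so that [//] closes the linearity side conditions of the Sweedler lemmas. *)
#[export] Hint Extern 0 (lin _) => solve [lin_tac] : core.
#[export] Hint Extern 0 (bilin _) => solve [lin_tac] : core.
#[export] Hint Extern 0 (trilin _) => solve [lin_tac] : core.

(** * Sweedler calculus *)

Section TensorCalculus.
Variable k : fieldType.
Implicit Types U V W T : lmodType k.

Lemma lin_pack V W (f : V -> W) : lin f -> exists F : {linear V -> W}, F =1 f.
Proof.
move=> hf.
pose F : {linear V -> W} := HB.pack f (GRing.isLinear.Build _ _ _ _ _ hf).
by exists F.
Qed.

Lemma scalar_pack V (f : V -> k) : scalar f -> exists F : {scalar V}, F =1 f.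
Proof.
move=> hf.
pose F : {scalar V} := HB.pack f (GRing.isLinear.Build _ _ _ _ _ hf).
by exists F.
Qed.

Lemma lin_tens_ext V W U (f g : tens V W -> U) :
  lin f -> lin g -> (forall v w, f (v ⊗ w) = g (v ⊗ w)) -> f =1 g.
Proof.
move=> hf hg h t; rewrite (tens_sum_pure t) !lin_bigsum //.
by apply: eq_bigr.
Qed.

Lemma tlift_tpure V W (t : tens V W) : \sw_(x ⊗ y <- t) x ⊗ y = t.
Proof. by rewrite [RHS]tens_sum_pure. Qed.

Lemma tlift_linear V W U T (g : U -> T) (f : V -> W -> U) t :
  lin g -> g (tlift f t) = tlift (fun v w => g (f v w)) t.
Proof. exact: linear_tlift. Qed.

Lemma tlift_tlift V W V' W' U (f : V' -> W' -> U) (g : V -> W -> tens V' W') t :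
  bilin f -> tlift f (tlift g t) = tlift (fun x y => tlift f (g x y)) t.
Proof. by move=> hf; apply: tlift_linear; apply: lin_tlift. Qed.

Lemma exchange_tlift V W V' W' U (f : V -> W -> V' -> W' -> U) s t :
  \sw_(x ⊗ y <- s) \sw_(z ⊗ w <- t) f x y z w =
  \sw_(z ⊗ w <- t) \sw_(x ⊗ y <- s) f x y z w.
Proof. exact: exchange_big. Qed.

Lemma tlift_addf V W U (f g : V -> W -> U) t :
  \sw_(x ⊗ y <- t) (f x y + g x y) = tlift f t + tlift g t.
Proof. exact: big_split. Qed.

Lemma tlift_scalef V W U (f : V -> W -> U) a t :
  \sw_(x ⊗ y <- t) (a *: f x y) = a *: tlift f t.
Proof. by rewrite [in RHS]/tlift /formal_eval scaler_sumr. Qed.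

Lemma tliftD V W U (f : V -> W -> U) s t : bilin f ->
  tlift f (s + t) = tlift f s + tlift f t.
Proof. by move=> hf; rewrite linD. Qed.

Lemma trilin_bilin V W T U (f : V -> W -> T -> U) :
  trilin f -> (forall x, bilin (f x)) /\ bilin (fun x u => tlift (f x) u).
Proof.
move=> [h1 h2 h3]; split=> [x|]; first exact: bilinI.
by apply: bilinI => [x|u]; [apply: lin_tlift; apply: bilinI|apply: lin_tlift_body].
Qed.

End TensorCalculus.

Section Sweedler.
Variable k : fieldType.
Implicit Types U V W T : lmodType k.

(** Trilinearity makes [x ⊗ (y ⊗ z) |-> f x y z] well defined on the nested tensor product, and the
    coassociativity identity is pushed through this map. *)
Lemma sw_coassoc V (D : V -> tens V V) c U (f : V -> V -> V -> U) :
  coassociative D -> trilin f ->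
  \sw_(x ⊗ y <- D c) \sw_(y1 ⊗ y2 <- D y) f x y1 y2 =
  \sw_(x ⊗ y <- D c) \sw_(x1 ⊗ x2 <- D x) f x1 x2 y.
Proof.
move=> hD hf; have [hb1 hb2] := trilin_bilin hf.
have := congr1 (tlift (fun x u => tlift (f x) u)) (hD c).
rewrite !tlift_tlift // => h.
transitivity (\sw_(x ⊗ y <- D c)
  tlift (fun x u => tlift (f x) u) (\sw_(y1 ⊗ y2 <- D y) x ⊗ (y1 ⊗ y2))).
  apply: eq_tlift => x y; rewrite tlift_tlift //; apply: eq_tlift => y1 y2.
  by rewrite !tlift_pure.
rewrite h; apply: eq_tlift => x y; rewrite tlift_tlift //.
by apply: eq_tlift => x1 x2; rewrite !tlift_pure.
Qed.

Section Hopf.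
Variables (A : algType k) (H : hopf A).

Lemma sw_comul_coassoc c U (f : A -> A -> A -> U) : trilin f ->
  \sw_(x ⊗ y <- comul H c) \sw_(y1 ⊗ y2 <- comul H y) f x y1 y2 =
  \sw_(x ⊗ y <- comul H c) \sw_(x1 ⊗ x2 <- comul H x) f x1 x2 y.
Proof. exact/sw_coassoc/comul_coassoc. Qed.

Lemma sw_comulM a b U (f : A -> A -> U) : bilin f ->
  tlift f (comul H (a * b)) =
  \sw_(a1 ⊗ a2 <- comul H a) \sw_(b1 ⊗ b2 <- comul H b) f (a1 * b1) (a2 * b2).
Proof.
move=> hf; rewrite comulM tlift_tlift //; apply: eq_tlift => a1 a2.
by rewrite tlift_tlift //; apply: eq_tlift => b1 b2; rewrite tlift_pure.
Qed.

Lemma sw_comul1 U (f : A -> A -> U) : bilin f -> tlift f (comul H 1) = f 1 1.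
Proof. by move=> hf; rewrite comul1 tlift_pure. Qed.

Lemma sw_counitl V (D : V -> tens V V) (e : {scalar V}) c U (f : V -> U) :
  counital D e -> lin f -> \sw_(x ⊗ y <- D c) e x *: f y = f c.
Proof.
move=> hD hf; rewrite -[in RHS](hD c).1 (tlift_linear _ _ hf).
by apply: eq_tlift => x y; rewrite linZ.
Qed.

Lemma sw_counitr V (D : V -> tens V V) (e : {scalar V}) c U (f : V -> U) :
  counital D e -> lin f -> \sw_(x ⊗ y <- D c) e y *: f x = f c.
Proof.
move=> hD hf; rewrite -[in RHS](hD c).2 (tlift_linear _ _ hf).
by apply: eq_tlift => x y; rewrite linZ.
Qed.

Lemma sw_comul_counitl c U (f : A -> U) : lin f ->
  \sw_(x ⊗ y <- comul H c) counit H x *: f y = f c.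
Proof. exact/sw_counitl/comul_counital. Qed.

Lemma sw_comul_counitr c U (f : A -> U) : lin f ->
  \sw_(x ⊗ y <- comul H c) counit H y *: f x = f c.
Proof. exact/sw_counitr/comul_counital. Qed.

Lemma sw_antipodel (C : algType k) (D : C -> tens C C) (e : {scalar C}) S c
    U (f : C -> U) :
  is_antipode D e S -> lin f -> \sw_(x ⊗ y <- D c) f (S x * y) = e c *: f 1.
Proof. by move=> hS hf; rewrite -tlift_linear // (hS c).1 linZ. Qed.

Lemma sw_antipoder (C : algType k) (D : C -> tens C C) (e : {scalar C}) S c
    U (f : C -> U) :
  is_antipode D e S -> lin f -> \sw_(x ⊗ y <- D c) f (x * S y) = e c *: f 1.
Proof. by move=> hS hf; rewrite -tlift_linear // (hS c).2 linZ. Qed.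

(** Coassociativity brings the second and third of four consecutive legs of [b] into one coproduct,
    where the antipode axiom applies. It serves to cancel the factor [S a_(1)] that crossed-module
    coactions create. *)
Lemma sw_antipode_collapse b U (f : A -> A -> A -> U) : trilin f ->
  \sw_(b1 ⊗ b2 <- comul H b) \sw_(p ⊗ q <- comul H b1) \sw_(c ⊗ r <- comul H b2)
    f p (q * antipode H c) r =
  \sw_(b1 ⊗ b2 <- comul H b) f b1 1 b2.
Proof.
move=> hf; rewrite -(sw_comul_coassoc _ (f := fun p q b2 =>
  \sw_(c ⊗ r <- comul H b2) f p (q * antipode H c) r)) //.
apply: eq_tlift => p b'.
rewrite (sw_comul_coassoc _ (f := fun q c r => f p (q * antipode H c) r)) //.
transitivity (\sw_(d ⊗ r <- comul H b') counit H d *: f p 1 r).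
  apply: eq_tlift => d r.
  by rewrite (sw_antipoder (f := fun t => f p t r) _ (antipodeP H)).
by rewrite sw_comul_counitl.
Qed.

Lemma antipode1 : antipode H 1 = 1.
Proof.
have [+ _] := antipodeP H 1; rewrite sw_comul1 //.
by rewrite mulr1 (counit_char H).1 scale1r.
Qed.

Lemma lin_aug_proj : lin (aug_proj H).
Proof.
move=> a u v; apply: val_inj; rewrite /= linearP scalerDl -scalerA.
by rewrite scalerBr addrACA -opprD.
Qed.

Hint Extern 0 (lin (aug_proj _)) => exact: lin_aug_proj : lindb.

Lemma aug_proj1 : aug_proj H 1 = 0.
Proof. by apply: val_inj; rewrite /= (counit_char H).1 scale1r subrr. Qed.

(** Passing from [c] to [c - ε(c) 1] adds only a multiple of a term with [π(1) = 0] in its first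
    leg. *)
Lemma sw_aug_coact c U (f : aug H -> A -> U) : bilin f ->
  tlift f (aug_coact (aug_proj H c)) =
  \sw_(c1 ⊗ c' <- comul H c) \sw_(c2 ⊗ c3 <- comul H c')
    f (aug_proj H c2) (antipode H c1 * c3).
Proof.
move=> hf; rewrite /aug_coact tlift_tlift //=.
transitivity (\sw_(c1 ⊗ c' <- comul H (c - counit H c *: 1))
  \sw_(c2 ⊗ c3 <- comul H c') f (aug_proj H c2) (antipode H c1 * c3)).
  apply: eq_tlift => c1 c'; rewrite tlift_tlift //.
  by apply: eq_tlift => c2 c3; rewrite tlift_pure.
rewrite linearB linearZ tliftD // linN // linZ // sw_comul1 // sw_comul1 //.
by rewrite aug_proj1 (lin0 (bilinl hf _)) scaler0 subr0.
Qed.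

Section CrossedModule.
Variables (V : lmodType k) (C : crossed_module H V).

Lemma bilin_act : bilin (act C). Proof. by case: (actP C). Qed.
Lemma lin_coact : lin (coact C). Proof. by case: (coactP C). Qed.
Lemma act1 v : act C v 1 = v.
Proof. by case: (actP C). Qed.

Lemma sw_coact_coassoc v U (f : V -> A -> A -> U) : trilin f ->
  \sw_(x ⊗ a <- coact C v) \sw_(y ⊗ b <- coact C x) f y b a =
  \sw_(x ⊗ a <- coact C v) \sw_(a1 ⊗ a2 <- comul H a) f x a1 a2.
Proof.
move=> hf; have [hb1 hb2] := trilin_bilin hf.
have [_ /(_ v) /(congr1 (tlift (fun x u => tlift (f x) u))) + _] := coactP C.
rewrite !tlift_tlift // => h.
transitivity (\sw_(x ⊗ y <- coact C v)
  tlift (fun x u => tlift (f x) u) (\sw_(y1 ⊗ y2 <- coact C x) y1 ⊗ (y2 ⊗ y))).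
  apply: eq_tlift => x y; rewrite tlift_tlift //; apply: eq_tlift => y1 y2.
  by rewrite !tlift_pure.
rewrite h; apply: eq_tlift => x y; rewrite tlift_tlift //.
by apply: eq_tlift => x1 x2; rewrite !tlift_pure.
Qed.

Lemma sw_coact_counit v U (f : V -> U) : lin f ->
  \sw_(x ⊗ a <- coact C v) counit H a *: f x = f v.
Proof.
move=> hf; have [_ _ h] := coactP C.
rewrite -[in RHS](h v) (tlift_linear _ _ hf).
by apply: eq_tlift => x y; rewrite linZ.
Qed.

Lemma sw_coact_act v a U (f : V -> A -> U) : bilin f ->
  tlift f (coact C (act C v a)) =
  \sw_(v0 ⊗ v1 <- coact C v) \sw_(a1 ⊗ a' <- comul H a)
    \sw_(a2 ⊗ a3 <- comul H a') f (act C v0 a2) (antipode H a1 * v1 * a3).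
Proof.
move=> hf; rewrite crossedP tlift_tlift //; apply: eq_tlift => v0 v1.
rewrite tlift_tlift //; apply: eq_tlift => a1 a'.
by rewrite tlift_tlift //; apply: eq_tlift => a2 a3; rewrite tlift_pure.
Qed.

End CrossedModule.
End Hopf.
End Sweedler.

#[export] Hint Extern 0 (lin (aug_proj _)) => exact: lin_aug_proj : lindb.
#[export] Hint Extern 0 (bilin (act _)) => exact: bilin_act : lindb.
#[export] Hint Extern 0 (lin (coact _)) => exact: lin_coact : lindb.

(** * Uniqueness of convolution inverses *)

Section Convolution.
Variables (k : fieldType) (V W B : lmodType k).
Variables (D : V -> tens V V) (e : {scalar V}) (D' : W -> tens W W) (e' : {scalar W}).
Hypotheses (hD : coassociative D) (he : counital D e).
Hypotheses (hD' : coassociative D') (he' : counital D' e').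
Variables (m : B -> B -> B) (u : B).
Hypotheses (hm : bilin m) (mA : associative m) (m1 : left_id u m) (m1r : right_id u m).

(** The convolution [F M G] is bracketed in two ways. The target algebra is a bare triple of space,
    product and unit, so that [La ⊗ A], which has no ring structure here, is allowed. *)
Lemma convolution_inverse_unique (F M G : V -> B) : lin F -> lin M -> lin G ->
  (forall c, \sw_(x ⊗ y <- D c) m (F x) (M y) = e c *: u) ->
  (forall c, \sw_(x ⊗ y <- D c) m (M x) (G y) = e c *: u) -> F =1 G.
Proof.
move=> hF hM hG hFM hMG c.
rewrite -(sw_counitr c he hF) -[RHS](sw_counitl c he hG).
transitivity (\sw_(x ⊗ y <- D c) \sw_(y1 ⊗ y2 <- D y) m (F x) (m (M y1) (G y2))).
  apply: eq_tlift => x y; rewrite -(tlift_linear _ _ (bilinr hm (F x))) hMG.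
  by rewrite (linZ _ _ (bilinr hm _)) m1r.
rewrite (sw_coassoc _ (f := fun x y z => m (F x) (m (M y) (G z)))) //.
apply: eq_tlift => x y; rewrite -{2}(m1 (G y)) -(linZ _ _ (bilinl hm _)) -hFM.
by rewrite (tlift_linear _ _ (bilinl hm _)); apply: eq_tlift => x1 x2; rewrite mA.
Qed.

(** The same argument on the tensor coalgebra of [V] and [W], with maps out of it kept as bilinear
    maps. It is applied to a product map and to an action. *)
Lemma convolution_inverse_unique2 (F M G : V -> W -> B) :
  bilin F -> bilin M -> bilin G ->
  (forall c d, \sw_(x ⊗ y <- D c) \sw_(z ⊗ w <- D' d) m (F x z) (M y w)
     = e c *: (e' d *: u)) ->
  (forall c d, \sw_(x ⊗ y <- D c) \sw_(z ⊗ w <- D' d) m (M x z) (G y w)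
     = e c *: (e' d *: u)) -> forall c d, F c d = G c d.
Proof.
move=> hF hM hG hFM hMG c d.
rewrite -(sw_counitr c he (bilinl hF d)) -[RHS](sw_counitl c he (bilinl hG d)).
transitivity (\sw_(x ⊗ y <- D c) \sw_(y1 ⊗ y2 <- D y)
    \sw_(z ⊗ w <- D' d) \sw_(w1 ⊗ w2 <- D' w) m (F x z) (m (M y1 w1) (G y2 w2))).
  apply: eq_tlift => x y; rewrite -(sw_counitr d he' (bilinr hF x)).
  rewrite -tlift_scalef exchange_tlift; apply: eq_tlift => z w.
  transitivity (m (F x z) (e y *: (e' w *: u))).
    by rewrite !(linZ _ _ (bilinr hm _)) m1r.
  rewrite -hMG (tlift_linear _ _ (bilinr hm _)); apply: eq_tlift => y1 y2.
  by rewrite (tlift_linear _ _ (bilinr hm _)).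
rewrite (sw_coassoc _ (f := fun x y1 y2 => \sw_(z ⊗ w <- D' d)
  \sw_(w1 ⊗ w2 <- D' w) m (F x z) (m (M y1 w1) (G y2 w2)))) //.
apply: eq_tlift => x y; rewrite -(sw_counitl d he' (bilinr hG y)).
transitivity (\sw_(x1 ⊗ x2 <- D x) \sw_(z ⊗ w <- D' d)
    \sw_(z1 ⊗ z2 <- D' z) m (F x1 z1) (m (M x2 z2) (G y w))).
  apply: eq_tlift => x1 x2.
  by rewrite (sw_coassoc _ (f := fun z w1 w2 => m (F x1 z) (m (M x2 w1) (G y w2)))).
rewrite exchange_tlift -tlift_scalef; apply: eq_tlift => z w.
transitivity (m (e x *: (e' z *: u)) (G y w)); last first.
  by rewrite !(linZ _ _ (bilinl hm _)) m1.
rewrite -hFM (tlift_linear _ _ (bilinl hm _)); apply: eq_tlift => x1 x2.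
rewrite (tlift_linear _ _ (bilinl hm _)); apply: eq_tlift => z1 z2.
by rewrite mA.
Qed.

End Convolution.

(** * Gradings and super products *)

Section Grading.
Variable k : fieldType.
Implicit Types V W U : lmodType k.

Lemma hcomp_bound V (G : grading V) v :
  exists N, forall n, (N <= n)%N -> hcomp G n v = 0.
Proof.
have [s hs] := (finite_seqP _).1 (hcomp_fin G v).
exists (\max_(i <- s) i).+1 => n hn; apply: contrapT => /eqP h.
have : n \in s by have : [set` s]%classic n by rewrite -hs.
by move=> /(@leq_bigmax_seq _ _ xpredT id)/= /(_ isT); rewrite leqNgt hn.
Qed.

Lemma fsum_bound V (F : nat -> V) N : (forall n, (N <= n)%N -> F n = 0) ->
  \sum_(n \in [set: nat]) F n = \sum_(n < N) F n.
Proof.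
move=> h; rewrite fsbig_ord; apply/esym/fsbig_widen => // n [_ /negP].
by rewrite -leqNgt => /h.
Qed.

Lemma homog_hcomp V (G : grading V) n v : homog G n (hcomp G n v).
Proof. by rewrite /homog hcomp_idem eqxx. Qed.

Lemma hcomp_homog V (G : grading V) m n v : homog G n v ->
  hcomp G m v = if m == n then v else 0.
Proof. by move=> hv; rewrite -{1}hv hcomp_idem hv. Qed.

Lemma homog_lin_ext V (G : grading V) W (f g : V -> W) : lin f -> lin g ->
  (forall n v, homog G n v -> f v = g v) -> f =1 g.
Proof.
move=> hf hg h v; rewrite -(hcomp_sum G v); have [N hN] := hcomp_bound G v.
rewrite (fsum_bound hN) !lin_bigsum //; apply: eq_bigr => i _.
exact: h (homog_hcomp _ _ _).
Qed.

Lemma fsum_homog V (G : grading V) W (F : nat -> V -> W) d v :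
  (forall n, lin (F n)) -> homog G d v ->
  \sum_(n \in [set: nat]) F n (hcomp G n v) = F d v.
Proof.
move=> hF hv; rewrite (@fsum_bound _ _ d.+1).
  rewrite big_ord_recr big1 /= ?add0r ?hv // => i _.
  by rewrite (hcomp_homog _ hv) (ltn_eqF (ltn_ord i)) lin0.
by move=> n hn; rewrite (hcomp_homog _ hv) (gtn_eqF hn) lin0.
Qed.

(** The support of the sum depends on the argument. Truncating at a common bound for [u] and [v],
    which also bounds their linear combination, leaves an ordinary finite sum. *)
Lemma lin_fsum_hcomp V (G : grading V) W (F : nat -> V -> W) :
  (forall n, lin (F n)) -> lin (fun v => \sum_(n \in [set: nat]) F n (hcomp G n v)).
Proof.
move=> hF a u v; have [[M hM] [N hN]] := (hcomp_bound G u, hcomp_bound G v).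
pose B := maxn M N.
have hu n : (B <= n)%N -> hcomp G n u = 0.
  by move=> h; apply/hM/leq_trans/h/leq_maxl.
have hv n : (B <= n)%N -> hcomp G n v = 0.
  by move=> h; apply/hN/leq_trans/h/leq_maxr.
rewrite !(@fsum_bound _ _ B) => [|n h|n h|n h].
- rewrite scaler_sumr -big_split /=; apply: eq_bigr => i _.
  by rewrite linearP hF.
- by rewrite hv // lin0.
- by rewrite hu // lin0.
- by rewrite linearP hu // hv // scaler0 addr0 lin0.
Qed.

Lemma lin_fsum_param V (G : grading V) W U (F : nat -> V -> W -> U) v :
  (forall n, bilin (F n)) ->
  lin (fun w => \sum_(n \in [set: nat]) F n (hcomp G n v) w).
Proof.
move=> hF a u w; have [N hN] := hcomp_bound G v.
rewrite !(@fsum_bound _ _ N) => [|n h|n h|n h];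
  rewrite ?hN //; try by apply: (@lin0 _ _ _ (fun v => F n v _)).
rewrite scaler_sumr -big_split /=; apply: eq_bigr => i _.
by rewrite (hF i).1.
Qed.

Lemma lin_ssign V (G : grading V) : lin (ssign G).
Proof. by apply: (@lin_fsum_hcomp _ _ _ (fun n v => (-1) ^+ n *: v)). Qed.

Lemma ssign_homog V (G : grading V) n v : homog G n v -> ssign G v = (-1) ^+ n *: v.
Proof. by move=> h; rewrite -[RHS](fsum_homog (F := fun n v => (-1) ^+ n *: v) _ h). Qed.

Lemma hcomp_degree_map V (GV : grading V) W (GW : grading W) (f : V -> W) n v :
  lin f -> degree_map GV GW 0 f -> hcomp GW n (f v) = f (hcomp GV n v).
Proof.
move=> hf hd; move: v; apply: (homog_lin_ext (G := GV)) => // m v hv.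
have := hd _ _ hv; rewrite addn0 => hw.
by rewrite (hcomp_homog _ hv) (hcomp_homog _ hw); case: ifP; rewrite // lin0.
Qed.

Lemma homog_sum V (G : grading V) n I r (P : pred I) F :
  (forall i, homog G n (F i)) -> homog G n (\sum_(i <- r | P i) F i).
Proof. by move=> h; rewrite /homog linear_sum; apply: eq_bigr => i _; apply: h. Qed.

Section SuperProduct.
Variables (B : algType k) (G : grading B).

(** The four linearity proofs differ by the place of the variable: [y] is decomposed by the outer
    sum and [x'] by the inner one, while [x] and [y'] are parameters of both. *)
Lemma lin_super_tmul1 y x' y' : lin (fun x => super_tmul G x y x' y').
Proof.
apply: (@lin_fsum_param _ G _ _ (fun m u x => \sum_(n \in [set: nat])
  (-1) ^+ (m * n) *: ((x * hcomp G n x') ⊗ (u * y')))) => m; split=> z.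
  exact: (@lin_fsum_param _ G _ _ (fun n w x => (-1) ^+ (m * n) *: ((x * w) ⊗ (z * y')))).
exact: (@lin_fsum_param _ G _ _ (fun n w u => (-1) ^+ (m * n) *: ((z * w) ⊗ (u * y')))).
Qed.

Lemma lin_super_tmul4 x y x' : lin (fun y' => super_tmul G x y x' y').
Proof.
apply: (@lin_fsum_param _ G _ _ (fun m u y' => \sum_(n \in [set: nat])
  (-1) ^+ (m * n) *: ((x * hcomp G n x') ⊗ (u * y')))) => m; split=> z.
  exact: (@lin_fsum_param _ G _ _ (fun n w y' => (-1) ^+ (m * n) *: ((x * w) ⊗ (z * y')))).
exact: (@lin_fsum_param _ G _ _ (fun n w u => (-1) ^+ (m * n) *: ((x * w) ⊗ (u * z)))).
Qed.

Lemma lin_super_tmul2 x x' y' : lin (fun y => super_tmul G x y x' y').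
Proof.
apply: (@lin_fsum_hcomp _ G _ (fun m u => \sum_(n \in [set: nat])
  (-1) ^+ (m * n) *: ((x * hcomp G n x') ⊗ (u * y')))) => m.
exact: (@lin_fsum_param _ G _ _ (fun n w u => (-1) ^+ (m * n) *: ((x * w) ⊗ (u * y')))).
Qed.

Lemma lin_super_tmul3 x y y' : lin (fun x' => super_tmul G x y x' y').
Proof.
apply: (@lin_fsum_param _ G _ _ (fun m u x' => \sum_(n \in [set: nat])
  (-1) ^+ (m * n) *: ((x * hcomp G n x') ⊗ (u * y')))) => m; split=> z.
  exact: (@lin_fsum_hcomp _ G _ (fun n w => (-1) ^+ (m * n) *: ((x * w) ⊗ (z * y')))).
exact: (@lin_fsum_param _ G _ _ (fun n w u => (-1) ^+ (m * n) *: ((x * w) ⊗ (u * y')))).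
Qed.

Lemma super_tmul_homog m n x y x' y' : homog G m y -> homog G n x' ->
  super_tmul G x y x' y' = (-1) ^+ (m * n) *: ((x * x') ⊗ (y * y')).
Proof.
move=> hy hx'; rewrite /super_tmul.
rewrite (fsum_homog (F := fun m u => \sum_(n \in [set: nat])
  (-1) ^+ (m * n) *: ((x * hcomp G n x') ⊗ (u * y'))) _ hy) => [|i].
  exact: (fsum_homog (F := fun n w => (-1) ^+ (m * n) *: ((x * w) ⊗ (y * y')))).
exact: (@lin_fsum_param _ G _ _ (fun n w u => (-1) ^+ (i * n) *: ((x * w) ⊗ (u * y')))).
Qed.

(** The product of the super tensor square; [sh_comulM] is, up to folding,
    [D (v * w) = smul (D v) (D w)]. *)
Definition smul (s t : tens B B) : tens B B :=
  \sw_(x ⊗ y <- s) \sw_(x' ⊗ y' <- t) super_tmul G x y x' y'.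

Lemma bilin_smul : bilin smul.
Proof.
have h x y : bilin (super_tmul G x y).
  by apply: bilinI => z; [apply: lin_super_tmul4|apply: lin_super_tmul3].
apply: bilinI => s; first by apply: lin_tlift_body => x y; exact: lin_tlift.
apply: lin_tlift; apply: bilinI => z; apply: lin_tlift_body => x y.
  exact: lin_super_tmul2.
exact: lin_super_tmul1.
Qed.

Lemma smul_pure x y x' y' : smul (x ⊗ y) (x' ⊗ y') = super_tmul G x y x' y'.
Proof.
have h u v : bilin (super_tmul G u v).
  by apply: bilinI => z; [apply: lin_super_tmul4|apply: lin_super_tmul3].
rewrite /smul tlift_pure ?tlift_pure //; apply: bilinI => z.
  by apply: lin_tlift_body => u v; exact: lin_super_tmul2.
by apply: lin_tlift_body => u v; exact: lin_super_tmul1.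
Qed.

Lemma smul_homog m n x y x' y' : homog G m y -> homog G n x' ->
  smul (x ⊗ y) (x' ⊗ y') = (-1) ^+ (m * n) *: ((x * x') ⊗ (y * y')).
Proof. by move=> hy hx'; rewrite smul_pure (super_tmul_homog _ _ hy hx'). Qed.

End SuperProduct.
End Grading.

#[export] Hint Extern 0 (bilin (smul _)) => exact: bilin_smul : lindb.
#[export] Hint Extern 0 (lin (ssign _)) => exact: lin_ssign : lindb.

Section SuperProductTheory.
Variables (k : fieldType) (B : algType k) (G : grading B).

Lemma smul0l x y x' y' : homog G 0 y ->
  smul G (x ⊗ y) (x' ⊗ y') = (x * x') ⊗ (y * y').
Proof.
move=> hy; move: x'; apply: (homog_lin_ext (G := G)) => // n x' hx'.
by rewrite (smul_homog _ _ hy hx') mul0n scale1r.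
Qed.

Lemma smul0r x y x' y' : homog G 0 x' ->
  smul G (x ⊗ y) (x' ⊗ y') = (x * x') ⊗ (y * y').
Proof.
move=> hx'; move: y; apply: (homog_lin_ext (G := G)) => // n y hy.
by rewrite (smul_homog _ _ hy hx') muln0 scale1r.
Qed.

Lemma smul0l_tens x y t : homog G 0 y ->
  smul G (x ⊗ y) t = \sw_(u ⊗ v <- t) (x * u) ⊗ (y * v).
Proof.
move=> hy; move: t; apply: lin_tens_ext => // u v.
by rewrite tlift_pure // smul0l.
Qed.

Lemma smul0r_tens x y t : homog G 0 x ->
  smul G t (x ⊗ y) = \sw_(u ⊗ v <- t) (u * x) ⊗ (v * y).
Proof.
move=> hy; move: t; apply: lin_tens_ext => // u v.
by rewrite tlift_pure // smul0r.
Qed.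

Hypothesis hG : graded_algebra G.

(** It suffices that the inner legs [y1], [x2], [y2], [x3] be homogeneous: both bracketings then
    carry the sign of exponent [|y1||x2| + |y1||x3| + |y2||x3|]. *)
Lemma smulA : associative (smul G).
Proof.
move=> s t u.
move: s; apply: lin_tens_ext => // x1 y1; move: y1.
apply: (homog_lin_ext (G := G)) => // m1 y1 h1.
move: t; apply: lin_tens_ext => // x2 y2; move: x2.
apply: (homog_lin_ext (G := G)) => // n2 x2 h2; move: y2.
apply: (homog_lin_ext (G := G)) => // m2 y2 h3.
move: u; apply: lin_tens_ext => // x3 y3; move: x3.
apply: (homog_lin_ext (G := G)) => // n3 x3 h4.
rewrite (smul_homog _ _ h3 h4) (smul_homog _ _ h1 h2).
rewrite (linZ _ _ (bilinr (bilin_smul G) _)) (linZ _ _ (bilinl (bilin_smul G) _)).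
rewrite (smul_homog _ _ h1 (hG.2 _ _ _ _ h2 h4)).
rewrite (smul_homog _ _ (hG.2 _ _ _ _ h1 h3) h4) !mulrA !scalerA -!exprD.
by congr (_ ^+ _ *: _); rewrite mulnDr mulnDl addnCA addnA addnC addnCA addnC.
Qed.

End SuperProductTheory.

Section BraidedProduct.
Variables (k : fieldType) (A : algType k) (H : hopf A) (B : algType k).
Variables (G : grading B) (C : crossed_module H B).

Let F x y' m n u w : tens B B :=
  (-1) ^+ (m * n) *: \sw_(z0 ⊗ z1 <- coact C w) (x * z0) ⊗ (act C u z1 * y').

Lemma lin_braided2 x x' y' : lin (fun y => braided_super_tmul G C x y x' y').
Proof.
apply: (@lin_fsum_hcomp _ _ G _ (fun m u => \sum_(n \in [set: nat])
  F x y' m n u (hcomp G n x'))) => m.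
by apply: (@lin_fsum_param _ _ G _ _ (fun n w u => F x y' m n u w)) => n; rewrite /F.
Qed.

Lemma lin_braided3 x y y' : lin (fun x' => braided_super_tmul G C x y x' y').
Proof.
apply: (@lin_fsum_param _ _ G _ _ (fun m u x' => \sum_(n \in [set: nat])
  F x y' m n u (hcomp G n x'))) => m; rewrite /F; apply: bilinI => z.
  by apply: (@lin_fsum_hcomp _ _ G _ (fun n w => F x y' m n z w)) => n; rewrite /F.
by apply: (@lin_fsum_param _ _ G _ _ (fun n w u => F x y' m n u w)) => n; rewrite /F.
Qed.

Lemma lin_braided1 y x' y' : lin (fun x => braided_super_tmul G C x y x' y').
Proof.
apply: (@lin_fsum_param _ _ G _ _ (fun m u x => \sum_(n \in [set: nat])
  F x y' m n u (hcomp G n x'))) => m; rewrite /F; apply: bilinI => z.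
  by apply: (@lin_fsum_param _ _ G _ _ (fun n w x => F x y' m n z w)) => n; rewrite /F.
by apply: (@lin_fsum_param _ _ G _ _ (fun n w u => F z y' m n u w)) => n; rewrite /F.
Qed.

Lemma lin_braided4 x y x' : lin (fun y' => braided_super_tmul G C x y x' y').
Proof.
apply: (@lin_fsum_param _ _ G _ _ (fun m u y' => \sum_(n \in [set: nat])
  F x y' m n u (hcomp G n x'))) => m; rewrite /F; apply: bilinI => z.
  by apply: (@lin_fsum_param _ _ G _ _ (fun n w y' => F x y' m n z w)) => n; rewrite /F.
by apply: (@lin_fsum_param _ _ G _ _ (fun n w u => F x z m n u w)) => n; rewrite /F.
Qed.

Lemma braided_super_tmul_homog m n x y x' y' : homog G m y -> homog G n x' ->
  braided_super_tmul G C x y x' y' =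
  (-1) ^+ (m * n) *: \sw_(z0 ⊗ z1 <- coact C x') (x * z0) ⊗ (act C y z1 * y').
Proof.
move=> hy hx'; rewrite /braided_super_tmul.
rewrite (fsum_homog (F := fun m u => \sum_(n \in [set: nat])
  F x y' m n u (hcomp G n x')) _ hy) => [|i].
  by rewrite (fsum_homog (F := fun n w => F x y' m n y w) _ hx') => [|j]; rewrite /F.
by apply: (@lin_fsum_param _ _ G _ _ (fun n w u => F x y' i n u w)) => j; rewrite /F.
Qed.

Definition bmul (s t : tens B B) : tens B B :=
  \sw_(x ⊗ y <- s) \sw_(x' ⊗ y' <- t) braided_super_tmul G C x y x' y'.

Let bilin34 x y : bilin (braided_super_tmul G C x y).
Proof. by apply: bilinI => z; [apply: lin_braided4|apply: lin_braided3]. Qed.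

Let bilin12 t :
  bilin (fun x y => \sw_(x' ⊗ y' <- t) braided_super_tmul G C x y x' y').
Proof.
apply: bilinI => z; apply: lin_tlift_body => x y.
  exact: lin_braided2.
exact: lin_braided1.
Qed.

Lemma bilin_bmul : bilin bmul.
Proof.
by apply: bilinI => s; [apply: lin_tlift_body => x y|]; exact: lin_tlift.
Qed.

Lemma bmul_homog m n x y x' y' : homog G m y -> homog G n x' ->
  bmul (x ⊗ y) (x' ⊗ y') =
  (-1) ^+ (m * n) *: \sw_(z0 ⊗ z1 <- coact C x') (x * z0) ⊗ (act C y z1 * y').
Proof.
by move=> hy hx'; rewrite /bmul !tlift_pure // (braided_super_tmul_homog _ _ hy hx').
Qed.

End BraidedProduct.

#[export] Hint Extern 0 (bilin (bmul _ _)) => exact: bilin_bmul : lindb.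

(** * The inclusion of and the projection to the coinvariants *)

Section Correspondence.
Variables (k : fieldType) (A : algType k) (H : hopf A) (Om La : algType k).
Variables (E : bicovariant_alg H Om) (X : bicovariant_data H La).
Implicit Types U : lmodType k.
Variables (phi : {linear tens A La -> Om}) (phiP : corresponds E X phi).

Local Notation ι := (iota E).
Local Notation ε := (counit H).
Local Notation "x ◁ a" := (act (La_cross X) x a) (at level 40, left associativity).

Definition incl (x : La) : Om := phi (1 ⊗ x).
Local Notation i := incl.

Lemma lin_incl : lin incl. Proof. by rewrite /incl. Qed.
Hint Extern 0 (lin incl) => exact: lin_incl : lindb.

Lemma phiE a x : phi (a ⊗ x) = ι a * i x.
Proof.
rewrite -(phi_iota phiP) (phi_mul phiP) sw_comul1 //.
by rewrite mulr1 act1 mul1r.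
Qed.

Lemma incl1 : i 1 = 1.
Proof. by rewrite /i (phi_iota phiP) rmorph1. Qed.

Lemma inclM x y : i (x * y) = i x * i y.
Proof. by rewrite /i (phi_mul phiP) sw_comul1 // mulr1 act1. Qed.

Lemma incl_iota x b : i x * ι b = \sw_(b1 ⊗ b2 <- comul H b) ι b1 * i (x ◁ b2).
Proof.
rewrite -(phi_iota phiP) /i (phi_mul phiP) tlift_linear //; apply: eq_tlift => b1 b2.
by rewrite mul1r mulr1 phiE.
Qed.

Lemma sw_incl_iota x b U (f : Om -> U) : lin f ->
  f (i x * ι b) = \sw_(b1 ⊗ b2 <- comul H b) f (ι b1 * i (x ◁ b2)).
Proof. by move=> hf; rewrite incl_iota tlift_linear. Qed.

Lemma Om_lin_ext U (f g : Om -> U) : lin f -> lin g ->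
  (forall a x, f (ι a * i x) = g (ι a * i x)) -> f =1 g.
Proof.
move=> hf hg h w; have [psi phiK psiK] := phi_bij phiP.
rewrite -(psiK w); move: (psi w); apply: lin_tens_ext => // a x.
by rewrite phiE.
Qed.

Lemma homog_incl n x : homog (La_gr X) n x -> homog (Om_gr E) n (i x).
Proof. exact: phi_graded. Qed.

Lemma homog_iota a : homog (Om_gr E) 0 (ι a).
Proof. by rewrite /homog -(iota_proj0 E) proj0_iota. Qed.

Lemma homog_iotaM n a w : homog (Om_gr E) n w -> homog (Om_gr E) n (ι a * w).
Proof. by move=> /((Om_graded E).2 _ _ _ _ (homog_iota a)). Qed.

Lemma homog_Miota n a w : homog (Om_gr E) n w -> homog (Om_gr E) n (w * ι a).
Proof.
by move=> /(fun h => (Om_graded E).2 _ _ _ _ h (homog_iota a)); rewrite addn0.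
Qed.

Lemma hcomp_phi n a x : hcomp (Om_gr E) n (ι a * i x) = ι a * i (hcomp (La_gr X) n x).
Proof.
apply: (hcomp_degree_map (f := fun x => ι a * i x)) => // m y hy.
by rewrite addn0; apply/homog_iotaM/homog_incl.
Qed.

Lemma ssign_incl x : ssign (Om_gr E) (i x) = i (ssign (La_gr X) x).
Proof.
move: x; apply: (homog_lin_ext (G := La_gr X)); [by []|by []|move=> n x hx].
by rewrite (ssign_homog hx) (ssign_homog (homog_incl hx)) (linZ _ _ lin_incl).
Qed.

(** The coaction preserves degrees, so the sign may be taken before or after it. *)
Lemma sw_coact_ssign x U (f : La -> A -> U) : bilin f ->
  tlift f (coact (La_cross X) (ssign (La_gr X) x)) =
  \sw_(x0 ⊗ x1 <- coact (La_cross X) x) f (ssign (La_gr X) x0) x1.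
Proof.
move=> hf; move: x; apply: (homog_lin_ext (G := La_gr X)); [by []|by []|move=> n x hx].
rewrite (ssign_homog hx) linZ // linZ // (La_coact_graded hx) !tlift_tlift //.
rewrite -tlift_scalef; apply: eq_tlift => x0 x1; rewrite !tlift_pure //.
by rewrite (ssign_homog (homog_hcomp _ _ _)) (linZ _ _ (bilinl hf _)).
Qed.

Lemma coL_phi a x : coL E (ι a * i x) = \sw_(a1 ⊗ a2 <- comul H a) a1 ⊗ (ι a2 * i x).
Proof. by rewrite -phiE (phi_coL phiP); apply: eq_tlift => a1 a2; rewrite phiE. Qed.

Lemma coR_phi a x : coR E (ι a * i x) =
  \sw_(a1 ⊗ a2 <- comul H a) \sw_(x0 ⊗ x1 <- coact (La_cross X) x)
    (ι a1 * i x0) ⊗ (a2 * x1).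
Proof.
rewrite -phiE (phi_coR phiP); apply: eq_tlift => a1 a2; apply: eq_tlift => x0 x1.
by rewrite phiE.
Qed.

Lemma coL_incl x : coL E (i x) = 1 ⊗ i x.
Proof. by rewrite -[i x]mul1r -(rmorph1 ι) coL_phi sw_comul1 // rmorph1 mul1r. Qed.

Lemma coR_incl x : coR E (i x) = \sw_(x0 ⊗ x1 <- coact (La_cross X) x) i x0 ⊗ x1.
Proof.
rewrite -[i x]mul1r -(rmorph1 ι) coR_phi sw_comul1 //.
by apply: eq_tlift => x0 x1; rewrite rmorph1 !mul1r.
Qed.

Lemma diff_phi a x : diff E (ι a * i x) =
  \sw_(a1 ⊗ a2 <- comul H a) ι a1 * i (omega X (aug_proj H a2) * x) +
  ι a * i (delta X x).
Proof.
rewrite -phiE (phi_diff phiP) linearD phiE tlift_linear //; congr (_ + _).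
by apply: eq_tlift => a1 a2; rewrite phiE.
Qed.

Lemma diff_incl x : diff E (i x) = i (delta X x).
Proof.
rewrite -[i x]mul1r -(rmorph1 ι) diff_phi sw_comul1 // aug_proj1 linear0 mul0r.
by rewrite (lin0 lin_incl) mulr0 add0r rmorph1 mul1r.
Qed.

Lemma diff_iota a : diff E (ι a) =
  \sw_(a1 ⊗ a2 <- comul H a) ι a1 * i (omega X (aug_proj H a2)).
Proof.
rewrite -[ι a]mulr1 -incl1 diff_phi.
(* The Leibniz rule for [1 = 1 * 1] reads [δ 1 = δ 1 + δ 1]. *)
have -> : delta X 1 = 0.
  have := @delta_super_derivation _ _ _ _ X 0 1 1 (La_graded X).1.
  rewrite !mulr1 mul1r expr0 scale1r => /eqP.
  by rewrite -subr_eq subrr eq_sym => /eqP.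
rewrite (lin0 lin_incl) mulr0 addr0.
by apply: eq_tlift => a1 a2; rewrite mulr1.
Qed.

Lemma proj0_phi (e : {scalar La}) a x :
  (forall x, hcomp (La_gr X) 0 x = e x *: 1) -> proj0 E (ι a * i x) = e x *: a.
Proof.
move=> he; apply: (can_inj (proj0_iota E)).
by rewrite iota_proj0 hcomp_phi he (linZ _ _ lin_incl) incl1 -scalerAr mulr1 linearZ.
Qed.

(** Because [Λ^0 = k], a functional that is [1] at [1] and vanishes in positive degree is
    determined. This expresses [proj0] by the braided counit. *)
Lemma hcomp0_counit (e : {scalar La}) x : e 1 = 1 -> graded_counit (La_gr X) e ->
  hcomp (La_gr X) 0 x = e x *: 1.
Proof.
move=> e1 he; move: x.
apply: (homog_lin_ext (G := La_gr X)) => [| |[|n] x hx]; first exact: lin_linear.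
- exact: lin_scalel.
- rewrite hx; have [c ->] := La_deg0 hx.
  by rewrite linearZ /= e1 mulr1.
by rewrite (hcomp_homog _ hx) (he _ _ hx) scale0r.
Qed.

Section Projection.
Variables (psi : Om -> tens A La) (phiK : cancel phi psi) (psiK : cancel psi phi).

Definition proj (w : Om) : La := \sw_(a ⊗ x <- psi w) ε a *: x.
Local Notation P := proj.

Lemma lin_proj : lin proj.
Proof.
have hpsi : lin psi by exact: (can2_linear phiK psiK).
by rewrite /proj.
Qed.
Hint Extern 0 (lin proj) => exact: lin_proj : lindb.

Lemma proj_phi a x : P (ι a * i x) = ε a *: x.
Proof. by rewrite /P -phiE phiK tlift_pure. Qed.

Lemma proj_incl x : P (i x) = x.
Proof. by rewrite -[i x]mul1r -(rmorph1 ι) proj_phi (counit_char H).1 scale1r. Qed.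

Lemma proj_iotaM a w : P (ι a * w) = ε a *: P w.
Proof.
move: w; apply: Om_lin_ext => // b x.
by rewrite mulrA -rmorphM !proj_phi (counit_char H).2 scalerA.
Qed.

Lemma proj_Mincl w y : P (w * i y) = P w * y.
Proof.
move: w; apply: Om_lin_ext => // a x.
by rewrite -mulrA -inclM !proj_phi scalerAl.
Qed.

(** The commutation rule [x b = b_(1) (x ◁ b_(2))], followed by [ε] on the left factor. *)
Lemma proj_Miota w b : P (w * ι b) = P w ◁ b.
Proof.
move: w; apply: Om_lin_ext => // a x.
rewrite -mulrA incl_iota (tlift_linear (g := fun w => P (ι a * w))) //.
transitivity (\sw_(b1 ⊗ b2 <- comul H b) ε b1 *: (ε a *: x ◁ b2)); last first.
  by rewrite sw_comul_counitl // proj_phi.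
apply: eq_tlift => b1 b2; rewrite proj_iotaM proj_phi (linZ _ _ (bilinl (bilin_act _) _)).
by rewrite !scalerA mulrC.
Qed.

Lemma hcomp_proj n w : hcomp (La_gr X) n (P w) = P (hcomp (Om_gr E) n w).
Proof.
move: w; apply: Om_lin_ext => // a x.
by rewrite hcomp_phi !proj_phi linearZ.
Qed.

Lemma homog_proj n w : homog (Om_gr E) n w -> homog (La_gr X) n (P w).
Proof. by rewrite /homog hcomp_proj => ->. Qed.

(** In [a_(1) ⊗ ω(π(a_(2))) x] the counit removes only [a_(1)], so [d] of the coefficient [a] leaves
    a trace after projection. This is the source of the [ω] term in the condition on [δ]. *)
Lemma proj_diff a x : P (diff E (ι a * i x)) =
  omega X (aug_proj H a) * x + ε a *: delta X x.
Proof.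
rewrite diff_phi (linD _ _ lin_proj) proj_phi; congr (_ + _).
rewrite tlift_linear //.
transitivity (\sw_(b1 ⊗ b2 <- comul H a) ε b1 *: (omega X (aug_proj H b2) * x)).
  by apply: eq_tlift => b1 b2; rewrite proj_phi.
by rewrite sw_comul_counitl.
Qed.

End Projection.
End Correspondence.

(** * From the super-Hopf algebra to the braided one *)

Section Forward.
Variables (k : fieldType) (A : algType k) (H : hopf A) (Om La : algType k).
Variables (E : bicovariant_alg H Om) (X : bicovariant_data H La).
Implicit Types U : lmodType k.
Variables (phi : {linear tens A La -> Om}) (phiP : corresponds E X phi).
Variables (psi : Om -> tens A La) (phiK : cancel phi psi) (psiK : cancel psi phi).
Variables (D : {linear Om -> tens Om Om}) (e : {scalar Om}) (S : {linear Om -> Om}).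
Hypotheses (hSH : super_hopf H E D e S) (hd : super_coderivation E D).
Hypothesis hL : forall w, coL E w = \sw_(x ⊗ y <- D w) proj0 E x ⊗ y.
Hypothesis hR : forall w, coR E w = \sw_(x ⊗ y <- D w) x ⊗ proj0 E y.

Local Notation ι := (iota E).
Local Notation ε := (counit H).
Local Notation i := (incl phi).
Local Notation P := (@proj k A H Om La psi).
Local Notation "x ◁ a" := (act (La_cross X) x a) (at level 40, left associativity).

Let lin_i : lin i. Proof. exact: lin_incl. Qed.
Let lin_P : lin P. Proof. exact: lin_proj phiK psiK. Qed.
Let PE := proj_phi phiP phiK.
Let PiM := proj_iotaM phiP phiK psiK.
Hint Extern 0 (lin (incl _)) => exact: lin_i : lindb.
Hint Extern 0 (lin (proj _ _)) => exact: lin_P : lindb.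

Lemma comul_iotaM a w : D (ι a * w) =
  \sw_(a1 ⊗ a2 <- comul H a) \sw_(u ⊗ v <- D w) (ι a1 * u) ⊗ (ι a2 * v).
Proof.
rewrite (sh_comulM hSH) -/(smul _ _ _) (sh_comul_iota hSH).
rewrite (tlift_linear _ _ (bilinl (bilin_smul _) _)); apply: eq_tlift => a1 a2.
by rewrite smul0l_tens //; apply: homog_iota.
Qed.

Lemma comul_Miota w a : D (w * ι a) =
  \sw_(u ⊗ v <- D w) \sw_(a1 ⊗ a2 <- comul H a) (u * ι a1) ⊗ (v * ι a2).
Proof.
rewrite (sh_comulM hSH) -/(smul _ _ _) (sh_comul_iota hSH).
rewrite (tlift_linear _ _ (bilinr (bilin_smul _) _)) exchange_tlift.
apply: eq_tlift => a1 a2.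
by rewrite smul0r_tens //; apply: homog_iota.
Qed.

(** This is the usual projection of a left Hopf module onto its coinvariants, for the coaction
    [(Π ⊗ id) D]. *)
Lemma incl_proj w : i (P w) = \sw_(u ⊗ v <- D w) ι (antipode H (proj0 E u)) * v.
Proof.
transitivity (\sw_(a ⊗ v <- coL E w) ι (antipode H a) * v); last first.
  by rewrite hL tlift_tlift //; apply: eq_tlift => u v; rewrite tlift_pure.
move: w; apply: (Om_lin_ext phiP) => // a x.
rewrite PE (coL_phi phiP) tlift_tlift // linZ //.
transitivity (\sw_(a1 ⊗ a2 <- comul H a) ι (antipode H a1 * a2) * i x).
  rewrite (sw_antipodel (f := fun a => ι a * i x) _ (antipodeP H)) //.
  by rewrite rmorph1 mul1r.
by apply: eq_tlift => a1 a2; rewrite tlift_pure // rmorphM mulrA.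
Qed.

(** The Hopf module decomposition: the left coaction followed by the projection to coinvariants
    inverts multiplication [A ⊗ La -> Om]. *)
Lemma iota_incl_proj w : \sw_(u ⊗ v <- D w) ι (proj0 E u) * i (P v) = w.
Proof.
transitivity (\sw_(a ⊗ v <- coL E w) ι a * i (P v)).
  by rewrite hL tlift_tlift //; apply: eq_tlift => u v; rewrite tlift_pure.
move: w; apply: (Om_lin_ext phiP) => // a x.
rewrite (coL_phi phiP) tlift_tlift //.
transitivity (\sw_(a1 ⊗ a2 <- comul H a) ε a2 *: (ι a1 * i x)).
  by apply: eq_tlift => a1 a2; rewrite tlift_pure // PE linZ // scalerAr.
by rewrite sw_comul_counitr.
Qed.

(* [i x] is left coinvariant, hence so is the first leg of [D (i x)]. *)
Lemma sw_comul_coinv x U (f : Om -> Om -> U) : bilin f ->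
  \sw_(u ⊗ v <- D (i x)) f (i (P u)) v = tlift f (D (i x)).
Proof.
move=> hf.
transitivity (\sw_(u ⊗ v <- D (i x)) \sw_(u1 ⊗ u2 <- D u)
    f (ι (antipode H (proj0 E u1)) * u2) v).
  by apply: eq_tlift => u v; rewrite incl_proj (tlift_linear _ _ (bilinl hf _)).
rewrite -(sw_coassoc _ (f := fun u1 u2 v => f (ι (antipode H (proj0 E u1)) * u2) v)
  (sh_coassoc hSH)) //.
transitivity (\sw_(a ⊗ v <- coL E (i x)) \sw_(v1 ⊗ v2 <- D v)
    f (ι (antipode H a) * v1) v2).
  rewrite hL tlift_tlift //; apply: eq_tlift => u v.
  by rewrite tlift_pure.
rewrite (coL_incl phiP) tlift_pure // antipode1 rmorph1.
by apply: eq_tlift => v1 v2; rewrite mul1r.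
Qed.

(** The first leg may be treated as coinvariant; its right coaction is [D] followed by [Π].
    Coassociativity moves this [Π] onto the second leg, where the Hopf module decomposition restores
    that leg. *)
Lemma sw_comul_bosonisation x : D (i x) =
  \sw_(u ⊗ v <- D (i x)) \sw_(y0 ⊗ y1 <- coact (La_cross X) (P u))
    i y0 ⊗ (ι y1 * i (P v)).
Proof.
transitivity (\sw_(u ⊗ v <- D (i x)) \sw_(w ⊗ a <- coR E (i (P u)))
    w ⊗ (ι a * i (P v))); last first.
  apply: eq_tlift => u v; rewrite (coR_incl phiP) tlift_tlift //.
  by apply: eq_tlift => y0 y1; rewrite tlift_pure.
rewrite (sw_comul_coinv _ (f := fun u v => \sw_(w ⊗ a <- coR E u) w ⊗ (ι a * i (P v)))) //.
transitivity (\sw_(u ⊗ v <- D (i x)) \sw_(u1 ⊗ u2 <- D u)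
   u1 ⊗ (ι (proj0 E u2) * i (P v))); last first.
  apply: eq_tlift => u v; rewrite hR tlift_tlift //.
  by apply: eq_tlift => u1 u2; rewrite tlift_pure.
rewrite -(sw_coassoc _ (f := fun u1 u2 v => u1 ⊗ (ι (proj0 E u2) * i (P v)))
  (sh_coassoc hSH)) // -[LHS]tlift_tpure.
apply: eq_tlift => u v.
rewrite -(tlift_linear (g := fun w => u ⊗ w)) //.
by rewrite iota_incl_proj.
Qed.

(** * The induced coproduct and counit of [La], and their axioms *)

Variables (Dl : {linear La -> tens La La}) (el : {scalar La}).
Hypothesis DlE : forall x, Dl x = \sw_(u ⊗ v <- D (i x)) P u ⊗ P v.
Hypothesis elE : forall x, el x = e (i x).

Lemma sw_comul_incl x U (f : Om -> Om -> U) : bilin f ->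
  tlift f (D (i x)) = \sw_(x1 ⊗ x2 <- Dl x) \sw_(y0 ⊗ y1 <- coact (La_cross X) x1)
    f (i y0) (ι y1 * i x2).
Proof.
move=> hf; rewrite sw_comul_bosonisation DlE !tlift_tlift //.
apply: eq_tlift => u v; rewrite tlift_tlift // tlift_pure //.
by apply: eq_tlift => y0 y1; rewrite tlift_pure.
Qed.

Lemma sw_comul_phi a x U (f : Om -> Om -> U) : bilin f ->
  tlift f (D (ι a * i x)) =
  \sw_(a1 ⊗ a2 <- comul H a) \sw_(x1 ⊗ x2 <- Dl x)
    \sw_(y0 ⊗ y1 <- coact (La_cross X) x1) f (ι a1 * i y0) (ι (a2 * y1) * i x2).
Proof.
move=> hf; rewrite comul_iotaM tlift_tlift //; apply: eq_tlift => a1 a2.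
rewrite tlift_tlift // sw_comul_incl //; apply: eq_tlift => x1 x2.
by apply: eq_tlift => y0 y1; rewrite tlift_pure // rmorphM mulrA.
Qed.

Lemma comul_super_bosonisation : super_bosonisation X phi Dl D.
Proof.
move=> a x; rewrite (phiE phiP) -[D _]tlift_tpure sw_comul_phi //.
apply: eq_tlift => a1 a2; apply: eq_tlift => x1 x2; apply: eq_tlift => y0 y1.
by rewrite !(phiE phiP).
Qed.

Lemma sw_comul_proj w U (f : La -> La -> U) : bilin f ->
  \sw_(u ⊗ v <- D w) f (P u) (P v) = tlift f (Dl (P w)).
Proof.
move=> hf; move: w; apply: (Om_lin_ext phiP) => // a x.
rewrite comul_iotaM tlift_tlift // PE linearZ linZ // DlE tlift_tlift //.
transitivity (\sw_(a1 ⊗ a2 <- comul H a) ε a1 *: (ε a2 *: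
  \sw_(u ⊗ v <- D (i x)) f (P u) (P v))).
  apply: eq_tlift => a1 a2; rewrite -!tlift_scalef tlift_tlift //.
  apply: eq_tlift => u v; rewrite tlift_pure // !PiM.
  by rewrite (linZ _ _ (bilinl hf _)) (linZ _ _ (bilinr hf _)).
rewrite sw_comul_counitl //.
by congr (_ *: _); apply: eq_tlift => u v; rewrite tlift_pure.
Qed.

Lemma counit_proj w : el (P w) = e w.
Proof.
(* Scalar-valued maps enter the extension principle as linear maps to the regular module [k^o]. *)
have lin_e : @lin k Om k^o e by exact: linearP.
have lin_el : @lin k La k^o el by exact: linearP.
move: w; apply: (@Om_lin_ext _ _ _ _ _ _ _ _ phiP k^o) => //.
  exact: lin_comp.
move=> a x; rewrite PE linearZ /= elE.
by rewrite (sh_counit_char hSH).2 (sh_counit_iota hSH).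
Qed.

Lemma comul_proj w : Dl (P w) = \sw_(u ⊗ v <- D w) P u ⊗ P v.
Proof. by rewrite -[LHS]tlift_tpure -sw_comul_proj. Qed.

Let Pi x : P (i x) = x. Proof. exact: (proj_incl phiP phiK). Qed.
Let P1 : P 1 = 1. Proof. by rewrite -(incl1 phiP) Pi. Qed.

Lemma lcomul_coassoc : coassociative Dl.
Proof.
move=> x; rewrite -(Pi x); set w := i x.
rewrite -(sw_comul_proj _ (f := fun x y => \sw_(y1 ⊗ y2 <- Dl y) x ⊗ (y1 ⊗ y2))) //.
rewrite -(sw_comul_proj _ (f := fun x y => \sw_(x1 ⊗ x2 <- Dl x) x1 ⊗ (x2 ⊗ y))) //.
transitivity (\sw_(u ⊗ v <- D w) \sw_(v1 ⊗ v2 <- D v) P u ⊗ (P v1 ⊗ P v2)).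
  apply: eq_tlift => u v.
  by rewrite -(sw_comul_proj _ (f := fun y1 y2 => P u ⊗ (y1 ⊗ y2))).
rewrite (sw_coassoc _ (f := fun u v1 v2 => P u ⊗ (P v1 ⊗ P v2)) (sh_coassoc hSH)) //.
apply: eq_tlift => u v.
by rewrite -(sw_comul_proj _ (f := fun y1 y2 => y1 ⊗ (y2 ⊗ P v))).
Qed.

Lemma lcomul_counital : counital Dl el.
Proof.
move=> x; rewrite -(Pi x); set w := i x.
rewrite -(sw_comul_proj _ (f := fun x y => el x *: y)) //.
rewrite -(sw_comul_proj _ (f := fun x y => el y *: x)) //.
split.
  rewrite -[RHS](sw_counitl (f := P) _ (sh_counital hSH)) //.
  by apply: eq_tlift => u v; rewrite counit_proj.
rewrite -[RHS](sw_counitr (f := P) _ (sh_counital hSH)) //.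
by apply: eq_tlift => u v; rewrite counit_proj.
Qed.

Lemma lcomul_graded : graded_coproduct (La_gr X) Dl.
Proof.
move=> n x hx; rewrite [LHS]DlE (sh_graded hSH (homog_incl phiP hx)) tlift_tlift //.
rewrite DlE tlift_tlift //.
apply: eq_tlift => u v; rewrite lin_bigsum // tlift_pure //.
apply: eq_bigr => j _.
by rewrite tlift_pure // !(hcomp_proj phiP phiK psiK).
Qed.

Lemma lcounit_graded : graded_counit (La_gr X) el.
Proof.
by move=> n x hx; rewrite elE; apply: (sh_counit_graded hSH); apply: homog_incl hx.
Qed.

Lemma lcomul_act x a : Dl (x ◁ a) =
  \sw_(x1 ⊗ x2 <- Dl x) \sw_(a1 ⊗ a2 <- comul H a) (x1 ◁ a1) ⊗ (x2 ◁ a2).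
Proof.
rewrite -{1}(Pi x) -(proj_Miota phiP phiK psiK) comul_proj comul_Miota tlift_tlift //.
rewrite DlE tlift_tlift //; apply: eq_tlift => u v; rewrite tlift_tlift // tlift_pure //.
by apply: eq_tlift => a1 a2; rewrite tlift_pure // !(proj_Miota phiP phiK psiK).
Qed.

(** Coassociativity with [Π] applied to the third leg. *)
Lemma coR_comul w U (f : Om -> Om -> A -> U) : trilin f ->
  \sw_(u ⊗ a <- coR E w) \sw_(u1 ⊗ u2 <- D u) f u1 u2 a =
  \sw_(u ⊗ v <- D w) \sw_(v0 ⊗ a <- coR E v) f u v0 a.
Proof.
move=> hf; rewrite hR tlift_tlift //.
transitivity (\sw_(u ⊗ v <- D w) \sw_(u1 ⊗ u2 <- D u) f u1 u2 (proj0 E v)).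
  by apply: eq_tlift => u v; rewrite tlift_pure.
rewrite -(sw_coassoc _ (f := fun u1 u2 v => f u1 u2 (proj0 E v)) (sh_coassoc hSH)) //.
apply: eq_tlift => u v; rewrite hR tlift_tlift //.
by apply: eq_tlift => v1 v2; rewrite tlift_pure.
Qed.

(** The image of the preceding identity at [i x] under [P ⊗ P ⊗ id]. The coaction of a second leg
    [ι y1 * i z] splits [y1]; [P] evaluates the left part by [ε], which leaves the codiagonal factor
    [y1 * z1]. *)
Lemma sw_lcomul_coact x U (f : La -> La -> A -> U) : trilin f ->
  \sw_(x0 ⊗ x1 <- coact (La_cross X) x) \sw_(u ⊗ v <- Dl x0) f u v x1 =
  \sw_(y ⊗ z <- Dl x) \sw_(y0 ⊗ y1 <- coact (La_cross X) y)
    \sw_(z0 ⊗ z1 <- coact (La_cross X) z) f y0 z0 (y1 * z1).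
Proof.
move=> hf.
transitivity (\sw_(u ⊗ a <- coR E (i x)) \sw_(u1 ⊗ u2 <- D u) f (P u1) (P u2) a).
  rewrite (coR_incl phiP) tlift_tlift //.
  apply: eq_tlift => x0 x1; rewrite tlift_pure //.
  by rewrite (sw_comul_proj _ (f := fun u v => f u v x1)) // Pi.
rewrite (coR_comul _ (f := fun u v a => f (P u) (P v) a)) // sw_comul_incl //.
apply: eq_tlift => y z; apply: eq_tlift => y0 y1.
rewrite (coR_phi phiP) tlift_tlift //.
transitivity (\sw_(a1 ⊗ a2 <- comul H y1) ε a1 *:
  \sw_(z0 ⊗ z1 <- coact (La_cross X) z) f y0 z0 (a2 * z1)).
  apply: eq_tlift => a1 a2; rewrite tlift_tlift // -tlift_scalef.
  apply: eq_tlift => z0 z1; rewrite tlift_pure // PE Pi.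
  by case: hf => _ h2 _; rewrite (linZ _ _ (h2 _ _)).
by rewrite (sw_comul_counitl _ _ (f := fun b =>
  \sw_(z0 ⊗ z1 <- coact (La_cross X) z) f y0 z0 (b * z1))).
Qed.

Lemma lcomul_coact x :
  \sw_(x0 ⊗ x1 <- coact (La_cross X) x) Dl x0 ⊗ x1 =
  \sw_(y ⊗ z <- Dl x) \sw_(y0 ⊗ y1 <- coact (La_cross X) y)
    \sw_(z0 ⊗ z1 <- coact (La_cross X) z) (y0 ⊗ z0) ⊗ (y1 * z1).
Proof.
rewrite -(sw_lcomul_coact _ (f := fun u v a => (u ⊗ v) ⊗ a)) //.
apply: eq_tlift => x0 x1; rewrite -{1}[Dl x0]tlift_tpure.
by rewrite (tlift_linear (g := fun t => t ⊗ x1)).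
Qed.

Lemma lcounit_act x a : el (x ◁ a) = el x * ε a.
Proof.
rewrite -{1}(Pi x) -(proj_Miota phiP phiK psiK) counit_proj.
by rewrite (sh_counit_char hSH).2 (sh_counit_iota hSH) elE.
Qed.

Lemma lcounit_char : is_character el.
Proof.
have [e1 eM] := sh_counit_char hSH.
by split=> [|x y]; rewrite !elE ?(incl1 phiP) ?(inclM phiP).
Qed.

(** As [Δ_R = (id ⊗ Π) D], the counit axiom of [D] reduces the left side to [Π (i x)], which is the
    degree zero part of [x]. *)
Lemma lcounit_coact x :
  \sw_(x0 ⊗ x1 <- coact (La_cross X) x) el x0 *: x1 = el x *: 1.
Proof.
rewrite -(proj0_phi phiP 1 _ (fun y => hcomp0_counit y lcounit_char.1 lcounit_graded)).
rewrite rmorph1 mul1r.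
transitivity (\sw_(u ⊗ a <- coR E (i x)) e u *: a).
  rewrite (coR_incl phiP) tlift_tlift //.
  by apply: eq_tlift => x0 x1; rewrite tlift_pure // elE.
rewrite hR tlift_tlift // -[RHS](sw_counitl (f := proj0 E) _ (sh_counital hSH)) //.
by apply: eq_tlift => u v; rewrite tlift_pure.
Qed.

Lemma lcomul1 : Dl 1 = 1 ⊗ 1.
Proof. by rewrite DlE (incl1 phiP) (sh_comul1 hSH) tlift_pure // P1. Qed.

(** In [D (i x) D (i y)] the inner legs [v] and [i z0] produce the super sign. The factor [ι z1] of
    the bosonised [D (i y)] stands to the right of [v], and [P (v * ι z1 * i y2) = (P v ◁ z1) * y2]
    turns it into the braiding. *)
Lemma lcomulM x y : Dl (x * y) = bmul (La_gr X) (La_cross X) (Dl x) (Dl y).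
Proof.
rewrite DlE (inclM phiP) (sh_comulM hSH) -/(smul _ _ _).
rewrite -[D (i y)]tlift_tpure (sw_comul_incl _ (f := @tpure _ _ _)) //.
rewrite (tlift_linear _ _ (bilinr (bilin_smul _) _)) tlift_tlift //.
rewrite -[Dl y in RHS]tlift_tpure (tlift_linear _ _ (bilinr (bilin_bmul _ _) _)).
apply: eq_tlift => y1 y2; rewrite DlE.
move: (D (i x)); apply: lin_tens_ext; [by []|by []|move=> u v].
rewrite [in RHS]tlift_pure; last by [].
suff h m n v' y1' : homog (Om_gr E) m v' -> homog (La_gr X) n y1' ->
  \sw_(p ⊗ q <- smul (Om_gr E) (u ⊗ v')
     (\sw_(z0 ⊗ z1 <- coact (La_cross X) y1') i z0 ⊗ (ι z1 * i y2))) P p ⊗ P q =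
  bmul (La_gr X) (La_cross X) (P u ⊗ P v') (y1' ⊗ y2).
  move: y1; apply: (homog_lin_ext (G := La_gr X)) => // n y1 hy.
  by move: v; apply: (homog_lin_ext (G := Om_gr E)) => // m v hv; apply: h hv hy.
move: v' y1' => {}v {}y1 hv hy.
rewrite (bmul_homog _ _ _ (homog_proj phiP phiK psiK hv) hy).
rewrite (La_coact_graded hy) !(@tlift_tlift _ La A) //.
rewrite (tlift_linear _ _ (bilinr (bilin_smul _) _)) tlift_tlift // -tlift_scalef.
apply: eq_tlift => z0 z1; rewrite !tlift_pure //.
have hz : homog (Om_gr E) n (i (hcomp (La_gr X) n z0)).
  exact: (homog_incl phiP (homog_hcomp _ _ _)).
rewrite (smul_homog _ _ hv hz) linZ // tlift_pure //; congr (_ *: (_ ⊗ _)).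
  by rewrite (proj_Mincl phiP phiK psiK).
by rewrite mulrA (proj_Mincl phiP phiK psiK) (proj_Miota phiP phiK psiK).
Qed.

(** On a summand [i y0 ⊗ ι y1 * i x2] of [D (i x)], the terms with [δ y0] and [δ x2] see [y1] only
    through [ε], whereas differentiating [ι y1] keeps it inside [ω]; this gives the three terms. *)
Lemma lcomul_delta : delta_condition X Dl.
Proof.
move=> x; rewrite [LHS]DlE -(diff_incl phiP) hd tlift_tlift //.
pose f u v := P (diff E u) ⊗ P v + P (ssign (Om_gr E) u) ⊗ P (diff E v).
transitivity (tlift f (D (i x))).
  by apply: eq_tlift => u v; rewrite tliftD // !tlift_pure.
rewrite sw_comul_incl; last by rewrite /f.
apply: eq_tlift => x1 x2; rewrite sw_coact_ssign // /f.
transitivity (\sw_(y0 ⊗ y1 <- coact (La_cross X) x1)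
  (ε y1 *: (delta X y0 ⊗ x2 + ssign (La_gr X) y0 ⊗ delta X x2) +
   ssign (La_gr X) y0 ⊗ (omega X (aug_proj H y1) * x2))).
  apply: eq_tlift => y0 y1; rewrite (diff_incl phiP) (ssign_incl phiP) !Pi PE.
  rewrite (proj_diff phiP phiK psiK) (linD _ _ (bilinr (bilin_tpure _ _) _)).
  rewrite !(linZ _ _ (bilinr (bilin_tpure _ _) _)) scalerDr -!addrA.
  by rewrite [_ + (_ *: _)]addrC.
by rewrite tlift_addf sw_coact_counit.
Qed.

(** Both sides are convolution inverses, on the tensor coalgebra of [A] and [Om], of the map
    [a, w |-> ι a * w]. No sign occurs because [ι a] has degree zero. *)
Lemma antipode_iotaM a w : S (ι a * w) = S w * ι (antipode H a).
Proof.
have [e1 eM] := sh_counit_char hSH.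
move: a w; apply: (convolution_inverse_unique2 (comul_coassoc H) (comul_counital H)
  (sh_coassoc hSH) (sh_counital hSH) (bilin_mul Om) (@mulrA Om) (@mul1r Om) (@mulr1 Om)
  (M := fun a w => ι a * w)) => [|||a w|a w]; [by []|by []|by []| |].
  transitivity (\sw_(u ⊗ v <- D (ι a * w)) S u * v).
    rewrite comul_iotaM tlift_tlift //; apply: eq_tlift => a1 a2.
    by rewrite tlift_tlift //; apply: eq_tlift => u v; rewrite tlift_pure.
  by rewrite (sw_antipodel (f := fun w => w) _ (sh_antipode hSH)) // eM
    (sh_counit_iota hSH) scalerA.
rewrite exchange_tlift.
transitivity (\sw_(u ⊗ v <- D w) \sw_(a1 ⊗ a2 <- comul H a)
   (ι a1 * (u * S v) * ι (antipode H a2))).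
  by apply: eq_tlift => u v; apply: eq_tlift => a1 a2; rewrite !mulrA.
rewrite exchange_tlift.
transitivity (\sw_(a1 ⊗ a2 <- comul H a) e w *: ι (a1 * antipode H a2)).
  apply: eq_tlift => a1 a2.
  rewrite (sw_antipoder (f := fun w => ι a1 * w * ι (antipode H a2)) _ (sh_antipode hSH)) //.
  by rewrite mulr1 rmorphM.
rewrite tlift_scalef (sw_antipoder (f := ι) _ (antipodeP H)) // rmorph1.
by rewrite !scalerA mulrC.
Qed.

(* The braided antipode, with values in [Om] until [incl_proj_S'] shows that
   they lie in the image of [i]. *)
Let S' x := \sw_(x0 ⊗ x1 <- coact (La_cross X) x) S (i x0) * ι x1.

Let lin_S' : lin S'. Proof. by rewrite /S'. Qed.

Let S'_incl x : \sw_(x1 ⊗ x2 <- Dl x) S' x1 * i x2 = el x *: 1.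
Proof.
rewrite elE -(sw_antipodel (f := fun w => w) _ (sh_antipode hSH)) // sw_comul_incl //.
apply: eq_tlift => x1 x2; rewrite /S' (tlift_linear (g := fun w => w * i x2)) //.
by apply: eq_tlift => y0 y1; rewrite mulrA.
Qed.

(** The right antipode axiom at [i y] leaves a factor [ι (S z1)] at the right end. Taking [y] to be
    the first leg of [Δ_R x] and multiplying by the second leg cancels it, because the coaction is
    codiagonal on [Dl x]. *)
Let incl_S' x : \sw_(x1 ⊗ x2 <- Dl x) i x1 * S' x2 = el x *: 1.
Proof.
have h y : \sw_(y1 ⊗ y2 <- Dl y) \sw_(z0 ⊗ z1 <- coact (La_cross X) y1)
    i z0 * S (i y2) * ι (antipode H z1) = el y *: 1.
  rewrite elE -(sw_antipoder (f := fun w => w) _ (sh_antipode hSH)) // sw_comul_incl //.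
  apply: eq_tlift => y1 y2; apply: eq_tlift => z0 z1.
  by rewrite antipode_iotaM mulrA.
transitivity (\sw_(x0 ⊗ b <- coact (La_cross X) x) (el x0 *: 1) * ι b); last first.
  transitivity (ι (\sw_(x0 ⊗ b <- coact (La_cross X) x) el x0 *: b)).
    rewrite (tlift_linear (g := ι)) //; apply: eq_tlift => x0 b.
    by rewrite linearZ -scalerAl mul1r.
  by rewrite lcounit_coact linearZ rmorph1.
transitivity (\sw_(x0 ⊗ b <- coact (La_cross X) x) \sw_(y1 ⊗ y2 <- Dl x0)
    \sw_(z0 ⊗ z1 <- coact (La_cross X) y1)
    i z0 * S (i y2) * ι (antipode H z1) * ι b); last first.
  apply: eq_tlift => x0 b; rewrite -h (tlift_linear (g := fun w => w * ι b)) //.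
  by apply: eq_tlift => y1 y2; rewrite (tlift_linear (g := fun w => w * ι b)).
rewrite (sw_lcomul_coact _ (f := fun y1 y2 b => \sw_(z0 ⊗ z1 <- coact (La_cross X) y1)
    i z0 * S (i y2) * ι (antipode H z1) * ι b)) //.
apply: eq_tlift => x1 x2; rewrite exchange_tlift.
rewrite (tlift_linear (g := fun w => i x1 * w)) //; apply: eq_tlift => y0 y1.
symmetry.
transitivity (\sw_(z ⊗ b <- coact (La_cross X) x1) \sw_(b1 ⊗ b2 <- comul H b)
  i z * S (i y0) * ι (antipode H b1 * b2 * y1)).
  rewrite -(sw_coact_coassoc _ _ (f := fun z b1 b2 =>
     i z * S (i y0) * ι (antipode H b1 * b2 * y1))) //.
  apply: eq_tlift => z b; apply: eq_tlift => z0 b0.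
  by rewrite !rmorphM !mulrA.
transitivity (\sw_(z ⊗ b <- coact (La_cross X) x1) ε b *: (i z * S (i y0) * ι y1)).
  apply: eq_tlift => z b.
  rewrite (sw_antipodel (f := fun c => i z * S (i y0) * ι (c * y1)) _ (antipodeP H)) //.
  by rewrite mul1r.
by rewrite sw_coact_counit // mulrA.
Qed.

(* Both sides are left convolution inverses of [i], as [P] is right [La]-linear. *)
Let incl_proj_S' x : i (P (S' x)) = S' x.
Proof.
move: x; apply: (convolution_inverse_unique lcomul_coassoc lcomul_counital
  (bilin_mul Om) (@mulrA Om) (@mul1r Om) (@mulr1 Om) (M := i)) => [|||x|x];
  [by []|by []|by []| |exact: incl_S'].
transitivity (i (P (\sw_(x1 ⊗ x2 <- Dl x) S' x1 * i x2))).
  rewrite (tlift_linear (g := fun w => i (P w))) //; apply: eq_tlift => x1 x2.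
  by rewrite (proj_Mincl phiP phiK psiK) (inclM phiP).
by rewrite S'_incl !linZ // P1 (incl1 phiP).
Qed.

Variable Sl : {linear La -> La}.
Hypothesis SlE : forall x,
  Sl x = P (\sw_(x0 ⊗ x1 <- coact (La_cross X) x) S (i x0) * ι x1).

Lemma lantipodeP : is_antipode Dl el Sl.
Proof.
move=> x; split.
  transitivity (P (\sw_(x1 ⊗ x2 <- Dl x) S' x1 * i x2)).
    rewrite (tlift_linear (g := P)) //; apply: eq_tlift => x1 x2.
    by rewrite (proj_Mincl phiP phiK psiK) SlE.
  by rewrite S'_incl linZ // P1.
rewrite -[LHS]Pi (tlift_linear (g := i)) //.
transitivity (P (\sw_(x1 ⊗ x2 <- Dl x) i x1 * S' x2)).
  by congr P; apply: eq_tlift => x1 x2; rewrite (inclM phiP) SlE incl_proj_S'.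
by rewrite incl_S' linZ // P1.
Qed.

Lemma lantipode_graded : degree_map (La_gr X) (La_gr X) 0 Sl.
Proof.
move=> n x hx; rewrite addn0 SlE; apply: (homog_proj phiP phiK psiK).
rewrite (La_coact_graded hx) tlift_tlift //; apply: homog_sum => p.
rewrite tlift_pure //; apply: homog_Miota.
have := sh_antipode_graded hSH (homog_incl phiP (homog_hcomp (La_gr X) n p.1)).
by rewrite addn0.
Qed.

(** Both sides are convolution inverses of the action on the tensor coalgebra of [La] and [A]: one
    because the coproduct is a module map, the other because the product is. *)
Lemma lantipode_act x a : Sl (x ◁ a) = Sl x ◁ a.
Proof.
have bA : bilin (act (La_cross X)) := bilin_act _.
move: x a; apply: (convolution_inverse_unique2 lcomul_coassoc lcomul_counital
  (comul_coassoc H) (comul_counital H) (bilin_mul La) (@mulrA La) (@mul1r La)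
  (@mulr1 La) (M := act (La_cross X))) => [|||x a|x a]; [by []|by []|by []| |].
  transitivity (\sw_(u ⊗ v <- Dl (x ◁ a)) Sl u * v).
    rewrite lcomul_act tlift_tlift //; apply: eq_tlift => x1 x2.
    by rewrite tlift_tlift //; apply: eq_tlift => a1 a2; rewrite tlift_pure.
  by rewrite (lantipodeP _).1 lcounit_act scalerA.
transitivity ((\sw_(x1 ⊗ x2 <- Dl x) x1 * Sl x2) ◁ a).
  rewrite (tlift_linear (g := fun y => y ◁ a)) //; apply: eq_tlift => x1 x2.
  by rewrite La_actM.
by rewrite (lantipodeP _).2 (linZ _ _ (bilinl bA a)) La_act1.
Qed.

(** Both sides are convolution inverses of the coaction, with values in [La ⊗ A] under the
    componentwise product [tm]: one because the product is a comodule map, the other because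
    coproduct and counit are. *)
Lemma lantipode_coact x : coact (La_cross X) (Sl x) =
  \sw_(x0 ⊗ x1 <- coact (La_cross X) x) Sl x0 ⊗ x1.
Proof.
pose tm (s t : tens La A) : tens La A :=
  \sw_(x ⊗ a <- s) \sw_(y ⊗ b <- t) (x * y) ⊗ (a * b).
have hm : bilin tm.
  by apply: bilinI => s; rewrite /tm; [apply: lin_tlift_body => u v|]; apply: lin_tlift.
have tmE x0 a y b : tm (x0 ⊗ a) (y ⊗ b) = (x0 * y) ⊗ (a * b).
  by rewrite /tm !tlift_pure.
have tmA : associative tm.
  move=> s t u; move: s; apply: lin_tens_ext; [by []|by []|move=> x1 a1].
  move: t; apply: lin_tens_ext; [by []|by []|move=> x2 a2].
  move: u; apply: lin_tens_ext; [by []|by []|move=> x3 a3].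
  by rewrite !tmE !mulrA.
have tm1l : left_id (1 ⊗ 1) tm.
  by apply: lin_tens_ext; [by []|by []|move=> y b]; rewrite tmE !mul1r.
have tm1r : right_id (1 ⊗ 1) tm.
  by apply: lin_tens_ext; [by []|by []|move=> y b]; rewrite tmE !mulr1.
move: x; apply: (convolution_inverse_unique lcomul_coassoc lcomul_counital
  hm tmA tm1l tm1r (M := coact (La_cross X))) => [|||x|x]; [by []|by []|by []| |].
  transitivity (coact (La_cross X) (\sw_(x1 ⊗ x2 <- Dl x) Sl x1 * x2)).
    rewrite (tlift_linear (g := coact (La_cross X))) //; apply: eq_tlift => x1 x2.
    by rewrite La_coactM.
  by rewrite (lantipodeP _).1 linZ // La_coact1.
transitivity (\sw_(x0 ⊗ b <- coact (La_cross X) x) \sw_(u ⊗ v <- Dl x0) (u * Sl v) ⊗ b).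
  rewrite (sw_lcomul_coact _ (f := fun u v b => (u * Sl v) ⊗ b)) //.
  apply: eq_tlift => x1 x2; rewrite -{1}[coact _ x1]tlift_tpure.
  rewrite (tlift_linear _ _ (bilinl hm _)); apply: eq_tlift => y0 y1.
  rewrite (tlift_linear _ _ (bilinr hm _)); apply: eq_tlift => z0 z1.
  by rewrite tmE.
transitivity (\sw_(x0 ⊗ b <- coact (La_cross X) x) (1 : La) ⊗ (el x0 *: b)).
  apply: eq_tlift => x0 b; rewrite -(tlift_linear (g := fun u => u ⊗ b)) //.
  rewrite (lantipodeP _).2 (linZ _ _ (bilinl (bilin_tpure _ _) _)).
  by rewrite (linZ _ _ (bilinr (bilin_tpure _ _) _)).
rewrite -(tlift_linear (g := fun b => (1 : La) ⊗ b)) // lcounit_coact.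
by rewrite (linZ _ _ (bilinr (bilin_tpure _ _) _)).
Qed.

Lemma lbraided_super_hopf : braided_super_hopf X Dl el Sl.
Proof.
split.
- exact: lcomul_coassoc.
- exact: lcomul_counital.
- exact: lcomul_graded.
- exact: lcounit_graded.
- exact: lantipode_graded.
- exact: lcomul_act.
- exact: lcomul_coact.
- exact: lcounit_act.
- exact: lcounit_coact.
- exact: lantipode_act.
- exact: lantipode_coact.
- exact: lcomul1.
- exact: lcomulM.
- exact: lcounit_char.
- exact: lantipodeP.
Qed.
End Forward.

(** * The super-bosonisation *)

Section Backward.
Variables (k : fieldType) (A : algType k) (H : hopf A) (Om La : algType k).
Variables (E : bicovariant_alg H Om) (X : bicovariant_data H La).
Implicit Types U : lmodType k.
Variables (phi : {linear tens A La -> Om}) (phiP : corresponds E X phi).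
Variables (psi : Om -> tens A La) (phiK : cancel phi psi) (psiK : cancel psi phi).
Variables (Dl : {linear La -> tens La La}) (el : {scalar La}) (Sl : {linear La -> La}).
Hypotheses (hB : braided_super_hopf X Dl el Sl) (hdelta : delta_condition X Dl).
Variable D : {linear Om -> tens Om Om}.
Hypothesis hD : super_bosonisation X phi Dl D.

Local Notation ι := (iota E).
Local Notation ε := (counit H).
Local Notation i := (incl phi).
Local Notation P := (@proj k A H Om La psi).
Local Notation C := (La_cross X).
Local Notation "x ◁ a" := (act C x a) (at level 40, left associativity).

Let lin_i : lin i. Proof. exact: lin_incl. Qed.
Let lin_P : lin P. Proof. exact: lin_proj phiK psiK. Qed.
Let PE := proj_phi phiP phiK.
Hint Extern 0 (lin (incl _)) => exact: lin_i : lindb.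
Hint Extern 0 (lin (proj _ _)) => exact: lin_P : lindb.

Let iota_incl1 a : ι a = ι a * i 1. Proof. by rewrite (incl1 phiP) mulr1. Qed.
Let one_incl x : i x = ι 1 * i x. Proof. by rewrite rmorph1 mul1r. Qed.

Lemma sw_braided_comul_act x a U (f : La -> La -> U) : bilin f ->
  tlift f (Dl (x ◁ a)) = \sw_(x1 ⊗ x2 <- Dl x) \sw_(a1 ⊗ a2 <- comul H a)
    f (x1 ◁ a1) (x2 ◁ a2).
Proof.
move=> hf; rewrite (bsh_comul_act hB) tlift_tlift //; apply: eq_tlift => x1 x2.
by rewrite tlift_tlift //; apply: eq_tlift => a1 a2; rewrite tlift_pure.
Qed.

Lemma sw_braided_comul_coact x U (f : La -> La -> A -> U) : trilin f ->
  \sw_(x0 ⊗ x1 <- coact C x) \sw_(u ⊗ v <- Dl x0) f u v x1 =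
  \sw_(y ⊗ z <- Dl x) \sw_(y0 ⊗ y1 <- coact C y) \sw_(z0 ⊗ z1 <- coact C z)
    f y0 z0 (y1 * z1).
Proof.
move=> hf; pose F (t : tens La La) a := \sw_(u ⊗ v <- t) f u v a.
have hF : bilin F by rewrite /F.
have := congr1 (tlift F) (bsh_comul_coact hB x); rewrite !tlift_tlift // => h.
transitivity (\sw_(x0 ⊗ x1 <- coact C x) tlift F (Dl x0 ⊗ x1)).
  by apply: eq_tlift => x0 x1; rewrite tlift_pure.
rewrite h; apply: eq_tlift => y z; rewrite tlift_tlift //; apply: eq_tlift => y0 y1.
rewrite tlift_tlift //; apply: eq_tlift => z0 z1.
by rewrite tlift_pure // /F tlift_pure.
Qed.

Lemma sw_braided_counit_coact x U (f : A -> U) : lin f ->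
  \sw_(x0 ⊗ x1 <- coact C x) el x0 *: f x1 = el x *: f 1.
Proof.
move=> hf; rewrite -linZ // -(bsh_counit_coact hB) tlift_linear //.
by apply: eq_tlift => x0 x1; rewrite linZ.
Qed.

Lemma sw_braided_counitl x U (f : La -> U) : lin f ->
  \sw_(x1 ⊗ x2 <- Dl x) el x1 *: f x2 = f x.
Proof. exact/sw_counitl/(bsh_counital hB). Qed.

Lemma sw_braided_counitr x U (f : La -> U) : lin f ->
  \sw_(x1 ⊗ x2 <- Dl x) el x2 *: f x1 = f x.
Proof. exact/sw_counitr/(bsh_counital hB). Qed.

Lemma sw_bosonisation_phi a x U (f : Om -> Om -> U) : bilin f ->
  tlift f (D (ι a * i x)) =
  \sw_(a1 ⊗ a2 <- comul H a) \sw_(x1 ⊗ x2 <- Dl x) \sw_(y0 ⊗ y1 <- coact C x1)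
    f (ι a1 * i y0) (ι (a2 * y1) * i x2).
Proof.
move=> hf; rewrite -(phiE phiP) hD tlift_tlift //; apply: eq_tlift => a1 a2.
rewrite tlift_tlift //; apply: eq_tlift => x1 x2.
rewrite tlift_tlift //; apply: eq_tlift => y0 y1.
by rewrite tlift_pure // !(phiE phiP).
Qed.

Lemma sw_bosonisation_incl x U (f : Om -> Om -> U) : bilin f ->
  tlift f (D (i x)) =
  \sw_(x1 ⊗ x2 <- Dl x) \sw_(y0 ⊗ y1 <- coact C x1) f (i y0) (ι y1 * i x2).
Proof.
move=> hf; rewrite one_incl sw_bosonisation_phi // sw_comul1 //.
by apply: eq_tlift => x1 x2; apply: eq_tlift => y0 y1; rewrite -one_incl mul1r.
Qed.

Lemma bosonisation_iota a :
  D (ι a) = \sw_(a1 ⊗ a2 <- comul H a) ι a1 ⊗ ι a2.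
Proof.
rewrite iota_incl1 -[LHS]tlift_tpure sw_bosonisation_phi //; apply: eq_tlift => a1 a2.
by rewrite (bsh_comul1 hB) tlift_pure // La_coact1 tlift_pure // mulr1 -!iota_incl1.
Qed.

Lemma bosonisation_coassoc : coassociative D.
Proof.
apply: (Om_lin_ext phiP); [by []|by []|move=> a x].
rewrite !sw_bosonisation_phi //.
(* Common form of both iterated coproducts, indexed by threefold coproducts of [a] and of [x]; the
   coaction leg of [p] is shared between the second and third factors. *)
pose F a1 a2 a3 p q r := \sw_(p0 ⊗ p' <- coact C p) \sw_(p1 ⊗ p2 <- comul H p')
  \sw_(q0 ⊗ q1 <- coact C q)
  (ι a1 * i p0) ⊗ ((ι (a2 * p1) * i q0) ⊗ (ι (a3 * (p2 * q1)) * i r)).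
transitivity (\sw_(a1 ⊗ a2 <- comul H a) \sw_(a3 ⊗ a4 <- comul H a2)
    \sw_(x1 ⊗ x2 <- Dl x) \sw_(x3 ⊗ x4 <- Dl x2) F a1 a3 a4 x1 x3 x4).
  apply: eq_tlift => a1 a2; rewrite exchange_tlift; apply: eq_tlift => x1 x2.
  transitivity (\sw_(y0 ⊗ y' <- coact C x1) \sw_(a3 ⊗ a4 <- comul H a2)
    \sw_(y1 ⊗ y2 <- comul H y') \sw_(x3 ⊗ x4 <- Dl x2) \sw_(q0 ⊗ q1 <- coact C x3)
    (ι a1 * i y0) ⊗ ((ι (a3 * y1) * i q0) ⊗ (ι (a4 * (y2 * q1)) * i x4))).
    apply: eq_tlift => y0 y'; rewrite sw_bosonisation_phi // sw_comulM //.
    apply: eq_tlift => a3 a4; apply: eq_tlift => y1 y2; apply: eq_tlift => x3 x4.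
    by apply: eq_tlift => q0 q1; rewrite mulrA.
  rewrite exchange_tlift; apply: eq_tlift => a3 a4; rewrite [RHS]exchange_tlift.
  by apply: eq_tlift => y0 y'; rewrite exchange_tlift.
rewrite (sw_comul_coassoc _ _ (f := fun a1 a3 a4 => \sw_(x1 ⊗ x2 <- Dl x)
  \sw_(x3 ⊗ x4 <- Dl x2) F a1 a3 a4 x1 x3 x4)); last by rewrite /F.
apply: eq_tlift => a1 a2.
transitivity (\sw_(a3 ⊗ a4 <- comul H a1) \sw_(x1 ⊗ x2 <- Dl x)
  \sw_(x3 ⊗ x4 <- Dl x1) F a3 a4 a2 x3 x4 x2).
  apply: eq_tlift => a3 a4.
  by rewrite (sw_coassoc _ (f := F a3 a4 a2) (bsh_coassoc hB)) // /F.
rewrite exchange_tlift; apply: eq_tlift => x1 x2.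
transitivity (\sw_(y0 ⊗ y1 <- coact C x1) \sw_(x3 ⊗ x4 <- Dl y0)
  \sw_(a3 ⊗ a4 <- comul H a1) \sw_(z0 ⊗ z1 <- coact C x3)
  (ι a3 * i z0) ⊗ ((ι (a4 * z1) * i x4) ⊗ (ι (a2 * y1) * i x2))); last first.
  apply: eq_tlift => y0 y1; rewrite sw_bosonisation_phi //.
  by rewrite exchange_tlift.
(* The coproduct of [La] is a comodule map, so the coaction leg [y1] taken before splitting becomes
   a product of the coaction legs of both parts. *)
rewrite (sw_braided_comul_coact _ (f := fun x3 x4 y1 =>
  \sw_(a3 ⊗ a4 <- comul H a1) \sw_(z0 ⊗ z1 <- coact C x3)
  (ι a3 * i z0) ⊗ ((ι (a4 * z1) * i x4) ⊗ (ι (a2 * y1) * i x2)))) //.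
rewrite exchange_tlift; apply: eq_tlift => p q.
transitivity (\sw_(a3 ⊗ a4 <- comul H a1) \sw_(q0 ⊗ q1 <- coact C q)
  \sw_(p0 ⊗ p1 <- coact C p) \sw_(z0 ⊗ z1 <- coact C p0)
  (ι a3 * i z0) ⊗ ((ι (a4 * z1) * i q0) ⊗ (ι (a2 * (p1 * q1)) * i x2))); last first.
  rewrite exchange_tlift [RHS]exchange_tlift; apply: eq_tlift => q0 q1.
  by rewrite exchange_tlift.
apply: eq_tlift => a3 a4; rewrite /F.
transitivity (\sw_(p0 ⊗ p' <- coact C p) \sw_(q0 ⊗ q1 <- coact C q)
  \sw_(p1 ⊗ p2 <- comul H p')
  (ι a3 * i p0) ⊗ ((ι (a4 * p1) * i q0) ⊗ (ι (a2 * (p2 * q1)) * i x2))).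
  by apply: eq_tlift => p0 p'; rewrite exchange_tlift.
rewrite exchange_tlift; apply: eq_tlift => q0 q1.
by rewrite -(sw_coact_coassoc _ _ (f := fun p0 p1 p2 =>
  (ι a3 * i p0) ⊗ ((ι (a4 * p1) * i q0) ⊗ (ι (a2 * (p2 * q1)) * i x2)))).
Qed.

Let hcomp0E x : hcomp (La_gr X) 0 x = el x *: 1.
Proof. exact: hcomp0_counit (bsh_counit_char hB).1 (bsh_counit_graded hB). Qed.

Lemma bosonisation_coL w : coL E w = \sw_(u ⊗ v <- D w) proj0 E u ⊗ v.
Proof.
move: w; apply: (Om_lin_ext phiP); [by []|by []|move=> a x].
rewrite (coL_phi phiP) sw_bosonisation_phi //; apply: eq_tlift => a1 a2.
transitivity (\sw_(x1 ⊗ x2 <- Dl x) el x1 *: (a1 ⊗ (ι a2 * i x2))).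
  by rewrite (sw_braided_counitl _ (f := fun x2 => a1 ⊗ (ι a2 * i x2))).
apply: eq_tlift => x1 x2; rewrite -{1}(mulr1 a2).
rewrite -(sw_braided_counit_coact x1 (f := fun y1 => a1 ⊗ (ι (a2 * y1) * i x2))) //.
apply: eq_tlift => y0 y1; rewrite (proj0_phi phiP _ _ hcomp0E).
by rewrite (linZ _ _ (bilinl (bilin_tpure _ _) _)).
Qed.

Lemma bosonisation_coR w : coR E w = \sw_(u ⊗ v <- D w) u ⊗ proj0 E v.
Proof.
move: w; apply: (Om_lin_ext phiP); [by []|by []|move=> a x].
rewrite (coR_phi phiP) sw_bosonisation_phi //; apply: eq_tlift => a1 a2.
rewrite -(sw_braided_counitr x (f := fun x => \sw_(y0 ⊗ y1 <- coact C x)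
  (ι a1 * i y0) ⊗ (a2 * y1))) //.
apply: eq_tlift => x1 x2; rewrite -tlift_scalef; apply: eq_tlift => y0 y1.
by rewrite (proj0_phi phiP _ _ hcomp0E) (linZ _ _ (bilinr (bilin_tpure _ _) _)).
Qed.

Lemma bosonisation1 : D 1 = 1 ⊗ 1.
Proof. by rewrite -(rmorph1 ι) bosonisation_iota sw_comul1 // rmorph1. Qed.

Lemma bosonisation_graded : graded_coproduct (Om_gr E) D.
Proof.
move=> n w hw.
pose Gr t := \sw_(x ⊗ y <- t) \sum_(j < n.+1)
  hcomp (Om_gr E) j x ⊗ hcomp (Om_gr E) (n - j) y.
have lGr : lin Gr by rewrite /Gr.
(* With [w] replaced by its degree [n] component, the claim is linear in an arbitrary [w] and can be
   tested on products [ι a * i x]. *)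
rewrite -[RHS]/(Gr (D w)) -hw; move: {hw} w.
apply: (Om_lin_ext phiP); [by []|by []|move=> a x].
rewrite (hcomp_phi phiP); set x' := hcomp _ _ x.
have hx : homog (La_gr X) n x' := homog_hcomp _ _ _.
rewrite -[in LHS](tlift_tpure (D _)) -[in RHS](tlift_tpure (D _)).
rewrite (tlift_linear _ _ lGr) !sw_bosonisation_phi //.
apply: eq_tlift => a1 a2; rewrite (bsh_graded hB hx) !tlift_tlift //.
apply: eq_tlift => x1 x2; rewrite !lin_bigsum //; apply: eq_bigr => [[j hj]] _ /=.
rewrite !tlift_pure // (La_coact_graded (homog_hcomp _ j x1)) !tlift_tlift //.
apply: eq_tlift => y0 y1; rewrite !tlift_pure // /Gr tlift_pure //.
have h0 : homog (Om_gr E) j (ι a1 * i (hcomp (La_gr X) j y0)).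
  exact/homog_iotaM/(homog_incl phiP)/homog_hcomp.
have h1 : homog (Om_gr E) (n - j) (ι (a2 * y1) * i (hcomp (La_gr X) (n - j) x2)).
  exact/homog_iotaM/(homog_incl phiP)/homog_hcomp.
rewrite (bigD1 (Ordinal hj)) //= h0 h1 big1 ?addr0 // => [[j' hj']] /= hn.
rewrite (hcomp_homog _ h0) ifN; last by apply: contra hn => /eqP e; apply/eqP/val_inj.
by rewrite (lin0 (bilinl (bilin_tpure _ _) _)).
Qed.

(** * Multiplicativity of the bosonised coproduct *)

Lemma bosonisation_iotaM a w :
  D (ι a * w) = smul (Om_gr E) (D (ι a)) (D w).
Proof.
move: w; apply: (Om_lin_ext phiP); [by []|by []|move=> b x].
rewrite bosonisation_iota (tlift_linear _ _ (bilinl (bilin_smul _) _)).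
rewrite mulrA -rmorphM -[LHS]tlift_tpure sw_bosonisation_phi // sw_comulM //.
apply: eq_tlift => a1 a2; rewrite smul0l_tens; last exact: homog_iota.
rewrite sw_bosonisation_phi //; apply: eq_tlift => b1 b2; apply: eq_tlift => x1 x2.
by apply: eq_tlift => y0 y1; rewrite mulrA -rmorphM mulrA -rmorphM mulrA.
Qed.

(** Here the crossed-module compatibility is used. Moving [b] to the left gives [b_(1) (x ◁ b_(2))],
    whose coaction contains the antipode of a leg of [b]; it meets the preceding leg and cancels,
    and what remains is the commutation rule in each tensor factor. *)
Lemma bosonisation_incl_iota x b :
  D (i x * ι b) = smul (Om_gr E) (D (i x)) (D (ι b)).
Proof.
rewrite bosonisation_iota (tlift_linear _ _ (bilinr (bilin_smul _) _)).
transitivity (\sw_(x1 ⊗ x2 <- Dl x) \sw_(y0 ⊗ y1 <- coact C x1)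
  \sw_(b1 ⊗ b2 <- comul H b) (i y0 * ι b1) ⊗ (ι y1 * i x2 * ι b2)); last first.
  transitivity (\sw_(b1 ⊗ b2 <- comul H b) \sw_(x1 ⊗ x2 <- Dl x)
      \sw_(y0 ⊗ y1 <- coact C x1) (i y0 * ι b1) ⊗ (ι y1 * i x2 * ι b2)).
    rewrite [RHS]exchange_tlift; apply: eq_tlift => x1 x2.
    by rewrite exchange_tlift.
  apply: eq_tlift => b1 b2; rewrite smul0r_tens; last exact: homog_iota.
  by rewrite sw_bosonisation_incl.
rewrite (incl_iota phiP) tlift_linear //.
transitivity (\sw_(x1 ⊗ x2 <- Dl x) \sw_(y0 ⊗ y1 <- coact C x1)
  \sw_(b1 ⊗ b2 <- comul H b) \sw_(p ⊗ t <- comul H b1)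
  \sw_(b3 ⊗ s <- comul H b2) \sw_(c ⊗ c' <- comul H b3) \sw_(q ⊗ r <- comul H c')
    (ι p * i (y0 ◁ q)) ⊗ (ι (t * antipode H c * y1 * r) * i (x2 ◁ s))).
  transitivity (\sw_(b1 ⊗ b2 <- comul H b) \sw_(p ⊗ t <- comul H b1)
   \sw_(x1 ⊗ x2 <- Dl x) \sw_(b3 ⊗ s <- comul H b2) \sw_(y0 ⊗ y1 <- coact C x1)
   \sw_(c ⊗ c' <- comul H b3) \sw_(q ⊗ r <- comul H c')
    (ι p * i (y0 ◁ q)) ⊗ (ι (t * antipode H c * y1 * r) * i (x2 ◁ s))).
    apply: eq_tlift => b1 b2; rewrite -[LHS]tlift_tpure sw_bosonisation_phi //.
    apply: eq_tlift => p t; rewrite sw_braided_comul_act //; apply: eq_tlift => x1 x2.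
    apply: eq_tlift => b3 s; rewrite sw_coact_act //; apply: eq_tlift => y0 y1.
    by apply: eq_tlift => c c'; apply: eq_tlift => q r; rewrite !mulrA.
  transitivity (\sw_(b1 ⊗ b2 <- comul H b) \sw_(x1 ⊗ x2 <- Dl x)
   \sw_(p ⊗ t <- comul H b1) \sw_(y0 ⊗ y1 <- coact C x1) \sw_(b3 ⊗ s <- comul H b2)
   \sw_(c ⊗ c' <- comul H b3) \sw_(q ⊗ r <- comul H c')
    (ι p * i (y0 ◁ q)) ⊗ (ι (t * antipode H c * y1 * r) * i (x2 ◁ s))).
    apply: eq_tlift => b1 b2; rewrite exchange_tlift; apply: eq_tlift => x1 x2.
    by apply: eq_tlift => p t; rewrite exchange_tlift.
  rewrite exchange_tlift; apply: eq_tlift => x1 x2; rewrite [RHS]exchange_tlift.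
  by apply: eq_tlift => b1 b2; rewrite exchange_tlift.
apply: eq_tlift => x1 x2; apply: eq_tlift => y0 y1.
pose G p t b2 := \sw_(c ⊗ s <- comul H b2) \sw_(q ⊗ r <- comul H c)
  (ι p * i (y0 ◁ q)) ⊗ (ι (t * y1 * r) * i (x2 ◁ s)).
transitivity (\sw_(b1 ⊗ b2 <- comul H b) \sw_(p ⊗ t <- comul H b1)
  \sw_(c ⊗ c' <- comul H b2) G p (t * antipode H c) c').
  apply: eq_tlift => b1 b2; apply: eq_tlift => p t.
  by rewrite -(sw_comul_coassoc _ _ (f := fun c c' s => \sw_(q ⊗ r <- comul H c')
    (ι p * i (y0 ◁ q)) ⊗ (ι (t * antipode H c * y1 * r) * i (x2 ◁ s)))).
(* The product [t * antipode H c] of adjacent legs of [b] is replaced by [1]. *)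
rewrite sw_antipode_collapse /G //.
transitivity (\sw_(b1 ⊗ b2 <- comul H b) \sw_(p ⊗ q <- comul H b1)
  \sw_(r ⊗ s <- comul H b2) (ι p * i (y0 ◁ q)) ⊗ (ι (y1 * r) * i (x2 ◁ s))).
  rewrite -(sw_comul_coassoc _ _ (f := fun p q b2 => \sw_(r ⊗ s <- comul H b2)
    (ι p * i (y0 ◁ q)) ⊗ (ι (y1 * r) * i (x2 ◁ s)))) //.
  apply: eq_tlift => p b'.
  rewrite [RHS](sw_comul_coassoc _ _ (f := fun q r s =>
    (ι p * i (y0 ◁ q)) ⊗ (ι (y1 * r) * i (x2 ◁ s)))) //.
  by apply: eq_tlift => c s; apply: eq_tlift => q r; rewrite mul1r.
apply: eq_tlift => b1 b2.
rewrite (sw_incl_iota phiP _ _ (f := fun w => w ⊗ (ι y1 * i x2 * ι b2))) //.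
apply: eq_tlift => p q; rewrite -mulrA.
rewrite (sw_incl_iota phiP _ _ (f := fun w => (ι p * i (y0 ◁ q)) ⊗ (ι y1 * w))) //.
by apply: eq_tlift => r s; rewrite mulrA rmorphM.
Qed.

(** Coassociativity of the coaction splits the leg [z1] of [y1] into a part multiplying [ι p1] and a
    part acting on [x2], which is exactly what commuting [i x2] past [ι z1] produces. *)
Lemma bosonisation_inclM x y :
  D (i x * i y) = smul (Om_gr E) (D (i x)) (D (i y)).
Proof.
pose BB (t : tens La La) : tens Om Om :=
  \sw_(x1 ⊗ x2 <- t) \sw_(y0 ⊗ y1 <- coact C x1) i y0 ⊗ (ι y1 * i x2).
have lBB : lin BB by rewrite /BB.
have DE z : D (i z) = BB (Dl z) by rewrite -[LHS]tlift_tpure sw_bosonisation_incl.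
rewrite -(inclM phiP) !DE (bsh_comulM hB) -/(bmul _ _ _ _).
move: (Dl x) (Dl y) => s t; move: s.
apply: lin_tens_ext; [by []|by []|move=> x1 x2].
move: t; apply: lin_tens_ext; [by []|by []|move=> y1 y2].
move: x2; apply: (homog_lin_ext (G := La_gr X)); [by []|by []|move=> m x2 hx].
move: y1; apply: (homog_lin_ext (G := La_gr X)); [by []|by []|move=> n y1 hy].
rewrite (bmul_homog _ _ _ hx hy) linZ // (tlift_linear _ _ lBB).
have BBE u v : BB (u ⊗ v) = \sw_(y0 ⊗ y1 <- coact C u) i y0 ⊗ (ι y1 * i v).
  by rewrite /BB tlift_pure.
rewrite !BBE (tlift_linear _ _ (bilinl (bilin_smul _) _)).
transitivity ((-1) ^+ (m * n) *: \sw_(p0 ⊗ p1 <- coact C x1)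
  \sw_(z0 ⊗ z1 <- coact C y1) \sw_(a1 ⊗ a2 <- comul H z1)
  (i p0 * i z0) ⊗ (ι p1 * ι a1 * i (x2 ◁ a2) * i y2)).
  congr (_ *: _); rewrite exchange_tlift.
  transitivity (\sw_(z0 ⊗ z1 <- coact C y1) \sw_(p0 ⊗ p1 <- coact C x1)
    \sw_(q0 ⊗ q1 <- coact C z0) (i p0 * i q0) ⊗ (ι p1 * ι q1 * i (x2 ◁ z1) * i y2)).
    apply: eq_tlift => z0 z1; rewrite BBE La_coactM tlift_tlift //.
    apply: eq_tlift => p0 p1; rewrite tlift_tlift //; apply: eq_tlift => q0 q1.
    by rewrite tlift_pure // !(inclM phiP) rmorphM !mulrA.
  rewrite exchange_tlift [RHS]exchange_tlift; apply: eq_tlift => p0 p1.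
  by rewrite (sw_coact_coassoc _ _ (f := fun q0 q1 z1 =>
     (i p0 * i q0) ⊗ (ι p1 * ι q1 * i (x2 ◁ z1) * i y2))).
rewrite -tlift_scalef; apply: eq_tlift => p0 p1.
rewrite (La_coact_graded hy) !(@tlift_tlift _ La A) //.
rewrite (tlift_linear _ _ (bilinr (bilin_smul _) _)) -tlift_scalef.
apply: eq_tlift => z0 z1; rewrite !(@tlift_pure _ La A) //.
have hz : homog (Om_gr E) n (i (hcomp (La_gr X) n z0)).
  exact: (homog_incl phiP (homog_hcomp _ _ _)).
have hv : homog (Om_gr E) m (ι p1 * i x2) by apply/homog_iotaM/(homog_incl phiP).
rewrite (smul_homog _ _ hv hz); congr (_ *: _).
rewrite [in RHS]mulrA -(mulrA (ι p1)).
rewrite (sw_incl_iota phiP _ _ (f := fun w =>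
  (i p0 * i (hcomp (La_gr X) n z0)) ⊗ (ι p1 * w * i y2))) //.
by apply: eq_tlift => a1 a2; rewrite !mulrA.
Qed.

Lemma bosonisationM v w : D (v * w) = smul (Om_gr E) (D v) (D w).
Proof.
have sA := smulA (Om_graded E).
have hi u y : D (u * i y) = smul (Om_gr E) (D u) (D (i y)).
  move: u; apply: (Om_lin_ext phiP); [by []|by []|move=> a x].
  by rewrite -mulrA bosonisation_iotaM bosonisation_inclM sA -bosonisation_iotaM.
have hj u b : D (u * ι b) = smul (Om_gr E) (D u) (D (ι b)).
  move: u; apply: (Om_lin_ext phiP); [by []|by []|move=> a x].
  by rewrite -mulrA bosonisation_iotaM bosonisation_incl_iota sA -bosonisation_iotaM.
move: w; apply: (Om_lin_ext phiP); [by []|by []|move=> b y].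
by rewrite mulrA !hi hj sA.
Qed.

(** In bidegrees [(0, 1)] and [(1, 0)] one leg lies in [Λ^0 = k] and is evaluated by the counit
    axiom. It is applied to the elements [ω(π(a))]. *)
Lemma lcomul_degree1 x : homog (La_gr X) 1 x -> Dl x = x ⊗ 1 + 1 ⊗ x.
Proof.
move=> hx.
have h0 : \sw_(x1 ⊗ x2 <- Dl x) hcomp (La_gr X) 0 x1 ⊗ hcomp (La_gr X) 1 x2 = 1 ⊗ x.
  rewrite -{2}hx -(sw_braided_counitl x (f := fun v => 1 ⊗ hcomp (La_gr X) 1 v)) //.
  apply: eq_tlift => x1 x2.
  by rewrite hcomp0E (linZ _ _ (bilinl (bilin_tpure _ _) _)).
have h1 : \sw_(x1 ⊗ x2 <- Dl x) hcomp (La_gr X) 1 x1 ⊗ hcomp (La_gr X) 0 x2 = x ⊗ 1.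
  rewrite -{2}hx -(sw_braided_counitr x (f := fun v => hcomp (La_gr X) 1 v ⊗ 1)) //.
  apply: eq_tlift => x1 x2.
  by rewrite hcomp0E (linZ _ _ (bilinr (bilin_tpure _ _) _)).
rewrite (bsh_graded hB hx) -h0 -h1 addrC -tlift_addf; apply: eq_tlift => x1 x2.
by rewrite !big_ord_recl big_ord0 addr0.
Qed.

(** * Compatibility of the bosonised coproduct with the differential *)

Let dd (t : tens Om Om) : tens Om Om :=
  \sw_(u ⊗ v <- t) (diff E u ⊗ v + ssign (Om_gr E) u ⊗ diff E v).

Let lin_dd : lin dd. Proof. by rewrite /dd. Qed.

Let ddE u v : dd (u ⊗ v) = diff E u ⊗ v + ssign (Om_gr E) u ⊗ diff E v.
Proof. by rewrite /dd tlift_pure. Qed.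

Let ssign_iota a : ssign (Om_gr E) (ι a) = ι a.
Proof. by rewrite (ssign_homog (homog_iota E a)) scale1r. Qed.

Let diff_iotaM a w : diff E (ι a * w) = diff E (ι a) * w + ι a * diff E w.
Proof. by rewrite (diff_super_derivation _ (homog_iota E a)) scale1r. Qed.

(** The Leibniz rule for the differential of the super tensor square. The degree one element
    [d (ι c)] passes the first leg [x] of [t] with the sign that [ssign] puts on [x]. *)
Let dd_smul b c t : dd (smul (Om_gr E) (ι b ⊗ ι c) t) =
  smul (Om_gr E) (dd (ι b ⊗ ι c)) t + smul (Om_gr E) (ι b ⊗ ι c) (dd t).
Proof.
move: t; apply: lin_tens_ext; [by []|by []|move=> x y].
move: x; apply: (homog_lin_ext (G := Om_gr E)); [by []|by []|move=> n x hx].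
have hc := homog_iota E c.
rewrite (smul0l _ _ _ hc) !ddE ssign_iota (ssign_homog hx).
rewrite (ssign_homog (homog_iotaM b hx)) (linD _ _ (bilinl (bilin_smul _) _)).
rewrite (linD _ _ (bilinr (bilin_smul _) _)) !(smul0l _ _ _ hc).
have := diff_degree hc; rewrite add0n => hdc.
rewrite (smul_homog _ _ hdc hx) mul1n !diff_iotaM -scalerAr.
rewrite !(linD _ _ (bilinr (bilin_tpure _ _) _)) !(linD _ _ (bilinl (bilin_tpure _ _) _)).
rewrite !(linZ _ _ (bilinl (bilin_tpure _ _) _)) -!addrA; congr (_ + _).
by rewrite addrCA.
Qed.

(** Since [ω(π(a_(2)))] is primitive, [D (d a)] has two parts. One is [a_(1) ⊗ d a_(2)] by
    coassociativity; the other contains the coaction [c_(2) ⊗ S c_(1) c_(3)] of [A^+], whose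
    antipode cancels against the preceding leg of [a]. *)
Let diff_comul_iota a : D (diff E (ι a)) = dd (D (ι a)).
Proof.
rewrite bosonisation_iota (tlift_linear _ _ lin_dd).
transitivity (\sw_(a1 ⊗ a2 <- comul H a)
  (diff E (ι a1) ⊗ ι a2 + ι a1 ⊗ diff E (ι a2))); last first.
  by apply: eq_tlift => a1 a2; rewrite ddE ssign_iota.
rewrite (diff_iota phiP) tlift_linear // tlift_addf.
transitivity (\sw_(a1 ⊗ a2 <- comul H a) \sw_(p ⊗ q <- comul H a1)
  (\sw_(y0 ⊗ y1 <- coact C (omega X (aug_proj H a2))) (ι p * i y0) ⊗ ι (q * y1)
   + ι p ⊗ (ι q * i (omega X (aug_proj H a2))))).
  apply: eq_tlift => a1 a2; rewrite -[LHS]tlift_tpure sw_bosonisation_phi //.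
  apply: eq_tlift => p q; rewrite (lcomul_degree1 (omega_degree X _)) tliftD //.
  rewrite !tlift_pure // La_coact1 tlift_pure // mulr1 -iota_incl1; congr (_ + _).
  by apply: eq_tlift => y0 y1; rewrite -iota_incl1.
transitivity (\sw_(a1 ⊗ a2 <- comul H a) (
  \sw_(p ⊗ q <- comul H a1) \sw_(y0 ⊗ y1 <- coact C (omega X (aug_proj H a2)))
    (ι p * i y0) ⊗ ι (q * y1) +
  \sw_(p ⊗ q <- comul H a1) ι p ⊗ (ι q * i (omega X (aug_proj H a2))))).
  by apply: eq_tlift => a1 a2; rewrite tlift_addf.
rewrite tlift_addf; congr (_ + _); last first.
  rewrite -(sw_comul_coassoc _ _ (f := fun p q a2 =>
    ι p ⊗ (ι q * i (omega X (aug_proj H a2))))) //.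
  apply: eq_tlift => a1 a2; rewrite (diff_iota phiP).
  by rewrite (tlift_linear _ _ (bilinr (bilin_tpure _ _) _)).
transitivity (\sw_(a1 ⊗ a2 <- comul H a) \sw_(p ⊗ q <- comul H a1)
  \sw_(c ⊗ r <- comul H a2) \sw_(c2 ⊗ c3 <- comul H r)
   (ι p * i (omega X (aug_proj H c2))) ⊗ ι (q * antipode H c * c3)).
  apply: eq_tlift => a1 a2; apply: eq_tlift => p q.
  rewrite omega_coact tlift_tlift //.
  rewrite (sw_aug_coact _ (f := fun x y => tlift _ (omega X x ⊗ y))) //.
  apply: eq_tlift => c r; apply: eq_tlift => c2 c3.
  by rewrite tlift_pure // mulrA.
rewrite (sw_antipode_collapse _ _ (f := fun p t r => \sw_(c2 ⊗ c3 <- comul H r)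
   (ι p * i (omega X (aug_proj H c2))) ⊗ ι (t * c3))) //.
rewrite (sw_comul_coassoc _ _ (f := fun p c2 c3 =>
   (ι p * i (omega X (aug_proj H c2))) ⊗ ι (1 * c3))) //.
apply: eq_tlift => a1 a2; rewrite (diff_iota phiP).
rewrite (tlift_linear _ _ (bilinl (bilin_tpure _ _) _)).
by apply: eq_tlift => p c2; rewrite mul1r.
Qed.

(** The [δ] of the first leg passes through the coaction because [δ] is a comodule map. The other
    two terms of the condition on [δ] combine, by coassociativity of the coaction, into [d] of the
    second leg [ι y1 * i x2]. *)
Let diff_comul_incl x : D (diff E (i x)) = dd (D (i x)).
Proof.
pose f u v := diff E u ⊗ v + ssign (Om_gr E) u ⊗ diff E v.
rewrite /dd -/f sw_bosonisation_incl; last by rewrite /f.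
rewrite (diff_incl phiP) -[LHS]tlift_tpure sw_bosonisation_incl // hdelta tlift_tlift //.
apply: eq_tlift => x1 x2; rewrite !tliftD // !tlift_pure //.
rewrite -addrA /f tlift_addf; congr (_ + _).
  rewrite delta_coact tlift_tlift //; apply: eq_tlift => y0 y1.
  by rewrite tlift_pure // (diff_incl phiP).
transitivity (\sw_(y0 ⊗ y1 <- coact C (ssign (La_gr X) x1))
    i y0 ⊗ diff E (ι y1 * i x2)); last first.
  rewrite sw_coact_ssign //; apply: eq_tlift => y0 y1.
  by rewrite (ssign_incl phiP).
rewrite tlift_tlift //.
transitivity (\sw_(z ⊗ b <- coact C (ssign (La_gr X) x1))
  (i z ⊗ (ι b * i (delta X x2)) + \sw_(a1 ⊗ a2 <- comul H b)
    i z ⊗ (ι a1 * i (omega X (aug_proj H a2) * x2)))).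
  rewrite tlift_addf -(sw_coact_coassoc _ _ (f := fun z a1 a2 =>
    i z ⊗ (ι a1 * i (omega X (aug_proj H a2) * x2)))) //.
  by congr (_ + _); apply: eq_tlift => z b; rewrite tlift_pure.
apply: eq_tlift => z b; rewrite (diff_phi phiP) addrC.
rewrite (linD _ _ (bilinr (bilin_tpure _ _) _)).
by rewrite (tlift_linear _ _ (bilinr (bilin_tpure _ _) _)).
Qed.

Lemma bosonisation_coderivation : super_coderivation E D.
Proof.
move=> w; rewrite -/(dd (D w)); move: w.
apply: (Om_lin_ext phiP); [by []|by []|move=> a x].
rewrite diff_iotaM linearD !bosonisationM diff_comul_iota diff_comul_incl.
move: (D (i x)) => t; rewrite bosonisation_iota.
rewrite (tlift_linear (g := fun s => dd (smul (Om_gr E) s t))) //.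
rewrite (tlift_linear (g := fun s => smul (Om_gr E) (dd s) t)) //.
rewrite (tlift_linear (g := fun s => smul (Om_gr E) s (dd t))) // -tlift_addf.
by apply: eq_tlift => a1 a2; rewrite dd_smul.
Qed.

(** * Counit and antipode of the super-bosonisation *)

Variables (e : {scalar Om}) (S : {linear Om -> Om}).
Hypothesis eE : forall w, e w = el (P w).
(** On [La] this is [S (i x) = i (Sl x0) * ι (antipode H x1)], solved from the defining relation of
    the braided antipode; antimultiplicativity then places the antipode of [a] on the right. *)
Hypothesis SE : forall w, S w = \sw_(a ⊗ x <- psi w)
  \sw_(x0 ⊗ x1 <- coact C x) i (Sl x0) * ι (antipode H (a * x1)).

Let S_phi a x : S (ι a * i x) =
  \sw_(x0 ⊗ x1 <- coact C x) i (Sl x0) * ι (antipode H (a * x1)).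
Proof. by rewrite SE -(phiE phiP) phiK tlift_pure. Qed.

Let e_phi a x : e (ι a * i x) = ε a * el x.
Proof. by rewrite eE PE linearZ. Qed.

Lemma bosonisation_counital : counital D e.
Proof.
move=> w; split; move: w; apply: (Om_lin_ext phiP); try by [];
  move=> a x; rewrite sw_bosonisation_phi //.
  transitivity (\sw_(a1 ⊗ a2 <- comul H a) ε a1 *:
    (\sw_(x1 ⊗ x2 <- Dl x) el x1 *: (ι a2 * i x2))).
    apply: eq_tlift => a1 a2; rewrite -tlift_scalef; apply: eq_tlift => x1 x2.
    rewrite -{2}(mulr1 a2) -(sw_braided_counit_coact _ (f := fun b => ι (a2 * b) * i x2)) //.
    by rewrite -tlift_scalef; apply: eq_tlift => y0 y1; rewrite e_phi scalerA.
  rewrite (sw_comul_counitl _ _ (f := fun b =>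
    \sw_(x1 ⊗ x2 <- Dl x) el x1 *: (ι b * i x2))) //.
  by rewrite (sw_braided_counitl _ (f := fun y => ι a * i y)).
transitivity (\sw_(a1 ⊗ a2 <- comul H a) ε a2 *:
  (\sw_(x1 ⊗ x2 <- Dl x) el x2 *: (ι a1 * i x1))).
  apply: eq_tlift => a1 a2; rewrite -tlift_scalef; apply: eq_tlift => x1 x2.
  rewrite -(sw_coact_counit C x1 (f := fun y => ι a1 * i y)) //.
  rewrite -!tlift_scalef; apply: eq_tlift => y0 y1.
  by rewrite e_phi (counit_char H).2 !scalerA -!mulrA [el x2 * _]mulrC.
rewrite (sw_comul_counitr _ _ (f := fun b =>
  \sw_(x1 ⊗ x2 <- Dl x) el x2 *: (ι b * i x1))) //.
by rewrite (sw_braided_counitr _ (f := fun y => ι a * i y)).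
Qed.

Lemma bosonisation_antipode : is_antipode D e S.
Proof.
have hA := antipodeP H.
move=> w; split; move: w.
  apply: (Om_lin_ext phiP); [by []| |move=> a x].
    exact: lin_scalel.
  rewrite sw_bosonisation_phi // exchange_tlift e_phi.
  transitivity (\sw_(x1 ⊗ x2 <- Dl x) ε a *: i (Sl x1 * x2)); last first.
    rewrite tlift_scalef -(tlift_linear (g := i)) // (bsh_antipode hB _).1.
    by rewrite (linZ _ _ lin_i) (incl1 phiP) scalerA.
  apply: eq_tlift => x1 x2.
  rewrite -(sw_coact_counit C x1 (f := fun y => i (Sl y * x2))) //.
  rewrite -tlift_scalef exchange_tlift.
  transitivity (\sw_(z0 ⊗ z1 <- coact C x1) \sw_(c1 ⊗ c2 <- comul H z1)
    \sw_(a1 ⊗ a2 <- comul H a)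
      i (Sl z0) * ι (antipode H (a1 * c1) * (a2 * c2)) * i x2).
    rewrite -(sw_coact_coassoc _ _ (f := fun z0 c1 c2 => \sw_(a1 ⊗ a2 <- comul H a)
      i (Sl z0) * ι (antipode H (a1 * c1) * (a2 * c2)) * i x2)) //.
    apply: eq_tlift => y0 y1; rewrite [RHS]exchange_tlift; apply: eq_tlift => a1 a2.
    rewrite S_phi (tlift_linear (g := fun w => w * (ι (a2 * y1) * i x2))) //.
    by apply: eq_tlift => z0 z1; rewrite !(rmorphM ι) !mulrA.
  apply: eq_tlift => y0 y1; rewrite exchange_tlift.
  (* The legs of [a] and of [y1] assemble into the coproduct of [a * y1], so one use of the antipode
     axiom of [A] removes both. *)
  rewrite -(sw_comulM _ _ _ (f := fun c1 c2 =>
    i (Sl y0) * ι (antipode H c1 * c2) * i x2)) //.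
  rewrite (sw_antipodel (f := fun c => i (Sl y0) * ι c * i x2) _ hA) //.
  by rewrite rmorph1 mulr1 (inclM phiP) (counit_char H).2 scalerA.
apply: (Om_lin_ext phiP); [by []| |move=> a x].
  exact: lin_scalel.
rewrite sw_bosonisation_phi // e_phi.
transitivity (\sw_(a1 ⊗ a2 <- comul H a) el x *: ι (a1 * antipode H a2)); last first.
  rewrite tlift_scalef (sw_antipoder (f := ι) _ hA) //.
  by rewrite rmorph1 !scalerA mulrC.
apply: eq_tlift => a1 a2.
(* The codiagonal coaction is read backwards: the coaction legs of both parts of [Dl x] become a
   single leg [b] of [x], which frees [u * Sl v] for the braided antipode axiom. *)
transitivity (\sw_(x0 ⊗ b <- coact C x) \sw_(u ⊗ v <- Dl x0)
   ι a1 * i (u * Sl v) * ι (antipode H (a2 * b))).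
  rewrite (sw_braided_comul_coact _ (f := fun u v b =>
    ι a1 * i (u * Sl v) * ι (antipode H (a2 * b)))) //.
  apply: eq_tlift => x1 x2; apply: eq_tlift => y0 y1.
  rewrite S_phi (tlift_linear (g := fun w => ι a1 * i y0 * w)) //.
  by apply: eq_tlift => z0 z1; rewrite (inclM phiP) !mulrA.
transitivity (\sw_(x0 ⊗ b <- coact C x) el x0 *: (ι a1 * ι (antipode H (a2 * b)))).
  apply: eq_tlift => x0 b.
  rewrite -(tlift_linear (g := fun y => ι a1 * i y * ι (antipode H (a2 * b)))) //.
  rewrite (bsh_antipode hB _).2 (linZ _ _ lin_i) (incl1 phiP).
  by rewrite -scalerAr mulr1 -scalerAl.
rewrite (sw_braided_counit_coact _ (f := fun b => ι a1 * ι (antipode H (a2 * b)))) //.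
by rewrite mulr1 rmorphM.
Qed.

Lemma bosonisation_counit_char : is_character e.
Proof.
have e1 := (bsh_counit_char hB).1.
split.
  by rewrite -(incl1 phiP) one_incl e_phi e1 (counit_char H).1 mulr1.
move=> v w.
have lk (V : lmodType k) (g : {scalar V}) : @lin k V k^o g by exact: linearP.
move: w; apply: (@Om_lin_ext _ _ _ _ _ _ _ _ phiP k^o).
- exact: (lin_comp (lk _ e)).
- by apply: (@lin_scale _ _ k^o).
move=> b y; rewrite e_phi !eE mulrA (proj_Mincl phiP phiK psiK).
rewrite (proj_Miota phiP phiK psiK) (bsh_counit_char hB).2 (bsh_counit_act hB).
by rewrite mulrA.
Qed.

Lemma bosonisation_super_hopf : super_hopf H E D e S.
Proof.
split.
- exact: bosonisation_coassoc.
- exact: bosonisation_counital.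
- exact: bosonisation_graded.
- move=> n w hw; rewrite eE; apply: (bsh_counit_graded hB (n := n)).
  exact: (homog_proj phiP phiK psiK hw).
- move=> n w hw; rewrite addn0 /homog -hw; move: {hw} w.
  apply: (Om_lin_ext phiP); [by []|by []|move=> a x].
  rewrite (hcomp_phi phiP) S_phi.
  rewrite (La_coact_graded (homog_hcomp _ _ _)) tlift_tlift //.
  apply: homog_sum => p; rewrite tlift_pure //.
  apply/homog_Miota/(homog_incl phiP).
  by have := bsh_antipode_graded hB (homog_hcomp (La_gr X) n p.1); rewrite addn0.
- exact: bosonisation1.
- exact: bosonisationM.
- exact: bosonisation_counit_char.
- exact: bosonisation_antipode.
- exact: bosonisation_iota.
- by move=> a; rewrite iota_incl1 e_phi (bsh_counit_char hB).1 mulr1.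
- move=> a; rewrite iota_incl1 S_phi La_coact1 tlift_pure //.
  (* The antipode axiom at the grouplike element [1]. *)
  have -> : Sl 1 = 1.
    have [+ _] := bsh_antipode hB 1; rewrite (bsh_comul1 hB) tlift_pure //.
    by rewrite mulr1 (bsh_counit_char hB).1 scale1r.
  by rewrite (incl1 phiP) mul1r mulr1.
Qed.
End Backward.

(** * Construction of the structure maps and the equivalence *)

Section Equivalence.
Variables (k : fieldType) (A : algType k) (H : hopf A) (Om La : algType k).
Variables (E : bicovariant_alg H Om) (X : bicovariant_data H La).
Variables (phi : {linear tens A La -> Om}) (phiP : corresponds E X phi).

Lemma strongly_bicovariant_braided (D : {linear Om -> tens Om Om}) :
  strongly_bicovariant_with E D ->
  exists Dl : {linear La -> tens La La},
    [/\ is_braided_super_hopf X Dl, delta_condition X Dl &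
        super_bosonisation X phi Dl D].
Proof.
move=> [[e [S hSH]] hd hL hR]; have [psi phiK psiK] := phi_bij phiP.
have lP : lin (proj H psi) := lin_proj H phiK psiK.
have li : lin (incl phi) := lin_incl phi.
have [Dl DlE] := @lin_pack _ _ _
  (fun x => \sw_(u ⊗ v <- D (incl phi x)) proj H psi u ⊗ proj H psi v) ltac:(by []).
have [el elE] : exists el : {scalar La}, forall x, el x = e (incl phi x).
  by apply: scalar_pack => a u v; rewrite li linearP.
have [Sl SlE] := @lin_pack _ _ _ (fun x => proj H psi
  (\sw_(x0 ⊗ x1 <- coact (La_cross X) x) S (incl phi x0) * iota E x1)) ltac:(by []).
exists Dl; split.
- exists el, Sl; exact: (lbraided_super_hopf phiP phiK psiK hSH hL hR DlE elE SlE).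
- exact: (lcomul_delta phiP phiK psiK hSH hd hL hR DlE).
- exact: (comul_super_bosonisation phiP phiK psiK hSH hL hR DlE).
Qed.

Lemma super_bosonisation_strongly_bicovariant (Dl : {linear La -> tens La La})
    (D : {linear Om -> tens Om Om}) :
  is_braided_super_hopf X Dl -> delta_condition X Dl ->
  super_bosonisation X phi Dl D -> strongly_bicovariant_with E D.
Proof.
move=> [el [Sl hB]] hdelta hD; have [psi phiK psiK] := phi_bij phiP.
have lP : lin (proj H psi) := lin_proj H phiK psiK.
have li : lin (incl phi) := lin_incl phi.
have lpsi : lin psi := can2_linear phiK psiK.
have [e eE] : exists e : {scalar Om}, forall w, e w = el (proj H psi w).
  by apply: scalar_pack => a u v; rewrite lP linearP.
have [S SE] := @lin_pack _ _ _ (fun w => \sw_(a ⊗ x <- psi w)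
  \sw_(x0 ⊗ x1 <- coact (La_cross X) x)
    incl phi (Sl x0) * iota E (antipode H (a * x1))) ltac:(by []).
split.
- by exists e, S; exact: (bosonisation_super_hopf phiP phiK psiK hB hD eE SE).
- exact: (bosonisation_coderivation phiP hB hdelta hD).
- exact: (bosonisation_coL phiP hB hD).
- exact: (bosonisation_coR phiP hB hD).
Qed.

(** The formula on [A ⊗ La] is transported along the inverse of [phi]; this provides the witness
    when only the structure on [La] is given. *)
Lemma super_bosonisation_exists (Dl : {linear La -> tens La La}) :
  exists D : {linear Om -> tens Om Om}, super_bosonisation X phi Dl D.
Proof.
have [psi phiK psiK] := phi_bij phiP.
have lpsi : lin psi := can2_linear phiK psiK.
have [D DE] := @lin_pack _ _ _ (fun w => \sw_(a ⊗ x <- psi w)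
  \sw_(a1 ⊗ a2 <- comul H a) \sw_(x1 ⊗ x2 <- Dl x)
    \sw_(y0 ⊗ y1 <- coact (La_cross X) x1)
      phi (a1 ⊗ y0) ⊗ phi ((a2 * y1) ⊗ x2)) ltac:(by []).
by exists D => a x; rewrite DE phiK tlift_pure.
Qed.

End Equivalence.

Theorem theorem3p7 (k : fieldType) (k_char : 2%N \notin [pchar k])
  (A : algType k) (H : hopf A) (antipode_bij : bijective (antipode H))
  (Om La : algType k) (E : bicovariant_alg H Om) (X : bicovariant_data H La)
  (phi : {linear tens A La -> Om}) (phiP : corresponds E X phi) :
  (strongly_bicovariant E <->
     exists DLa : {linear La -> tens La La},
       is_braided_super_hopf X DLa /\ delta_condition X DLa) /\
  (forall DOm : {linear Om -> tens Om Om},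
     strongly_bicovariant_with E DOm <->
     exists DLa : {linear La -> tens La La},
       [/\ is_braided_super_hopf X DLa, delta_condition X DLa &
           super_bosonisation X phi DLa DOm]).
Proof.
split=> [|D]; split.
- move=> [D /(strongly_bicovariant_braided phiP) [Dl [hB hd _]]].
  by exists Dl.
- move=> [Dl [hB hd]]; have [D hD] := super_bosonisation_exists phiP Dl.
  exists D; exact: super_bosonisation_strongly_bicovariant phiP _ _ hB hd hD.
- exact: strongly_bicovariant_braided.
- move=> [Dl [hB hd hD]].
  exact: super_bosonisation_strongly_bicovariant phiP _ _ hB hd hD.
Qed.
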